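(* Let $M$ be a smooth manifold. There is a $2$-category $\mathbf{BGrb}_M$ whose objects are the bundle gerbes on $M$, whose $1$-arrows are the bundle gerbe morphisms $P\to Q$, and whose $2$-arrows are the transformations $\theta\colon f\Rightarrow g$ between bundle gerbe morphisms, with composition of $1$-arrows, vertical and horizontal composition of $2$-arrows, and identities as given in the context.
   Context: **Conventions.** Manifolds (possibly infinite dimensional) and maps are smooth. A $\mathbb{C}^\times$ bundle is a principal $\mathbb{C}^\times$-bundle; $P\otimes Q$ is the contracted product of $\mathbb{C}^\times$ bundles. For a surjection $\pi\colon X\to M$ admitting local sections, $X^{[p]}=X\times_M\cdots\times_M X$ ($p$ factors), and $\pi_i\colon X^{[p+1]}\to X^{[p]}$ omits the $i$-th factor. **Bundle gerbes.** A bundle gerbe on $M$ is a triple $(P,X,M)$ (abbreviated $(P,X)$ or $P$), where $\pi\colon X\to M$ is a surjection admitting local sections and $P\to X^{[2]}$ is a $\mathbb{C}^\times$ bundle with a product: an isomorphism $\pi_1^{-1}P\otimes\pi_3^{-1}P\to\pi_2^{-1}P$ over $X^{[3]}$, fibrewise $P_{(x_2,x_3)}\otimes P_{(x_1,x_2)}\to P_{(x_1,x_3)}$, $u_{23}\otimes u_{12}\mapsto u_{23}u_{12}$, which is associative over $X^{[4]}$. There are an identity section $e$, with $e(x)\in P_{(x,x)}$, and inverses $u^{-1}\in P_{(x_2,x_1)}$ for $u\in P_{(x_1,x_2)}$. A bundle gerbe morphism $f\colon (P,X)\to(Q,Y)$ over $M$ is a pair $f=(\hat f,f)$ where $f\colon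 X\to Y$ is a map over $\mathrm{id}_M$ and $\hat f\colon P\to Q$ is a $\mathbb{C}^\times$ bundle morphism covering $f^{[2]}\colon X^{[2]}\to Y^{[2]}$ and commuting with the products. **Transformations.** For bundle gerbe morphisms $f,g\colon (P,X)\to (Q,Y)$ let $\hat D_{f,g}=(f,g)^{-1}Q$, the $\mathbb{C}^\times$ bundle on $X$ with fibre $Q_{(f(x),g(x))}$ at $x$. It has a descent isomorphism $(\hat D_{f,g})_{x_1}\to(\hat D_{f,g})_{x_2}$ for $(x_1,x_2)\in X^{[2]}$, $v\mapsto \hat g(u)\,(v\,\hat f(u^{-1}))$ for any $u\in P_{(x_1,x_2)}$ (independent of $u$), and so descends to a $\mathbb{C}^\times$ bundle $D_{f,g}$ on $M$. A transformation $\theta\colon f\Rightarrow g$ is a section of $D_{f,g}$. Equivalently, it is a section $\hat\theta$ of $\hat D_{f,g}$ with $\hat\theta(x_2)\hat f(u)=\hat g(u)\hat\theta(x_1)$ for all $u\in P_{(x_1,x_2)}$ (the lift of $\theta$). **Compositions.** $1$-arrows compose by composing maps: $g\circ f=(\hat g\circ\hat f,g\circ f)$; the identity $1$-arrow is the identity morphism. For $\theta\colon f\Rightarrow g$ and $\lambda\colon g\Rightarrow h$, the vertical composite $\lambda\theta\colon f\Rightarrow h$ is the transformation with lift $x\mapsto\hat\lambda(x)\hat\theta(x)$; the identity $1_f\colon f\Rightarrow f$ has lift $x\mapsto e(f(x))$. For $f_1,f_2\colon P\to Q$, $g_1,g_2\colon Q\to R$, $\theta\colon f_1\Rightarrow f_2$,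 $\lambda\colon g_1\Rightarrow g_2$, the horizontal composite $\lambda\circ\theta\colon g_1\circ f_1\Rightarrow g_2\circ f_2$ has lift $x\mapsto \hat g_2(\hat\theta(x))\,\hat\lambda(f_1(x))$. *)

(* Defs.v *)
From HB Require Import structures.
From mathcomp Require Import all_boot all_order all_algebra.
From mathcomp Require Import all_classical all_reals all_analysis.
From mathcomp Require Import complex.

Set Implicit Arguments.
Unset Strict Implicit.
Unset Printing Implicit Defensive.

Import Order.TTheory GRing.Theory Num.Theory.
Import numFieldNormedType.Exports.

Local Open Scope ring_scope.
Local Open Scope classical_set_scope.

(* Possibly infinite-dimensional calculus in the sense of Michal-Bastiani:
   [f] is C^(k+1) on the open set [U] when it is continuous, has all
   directional derivatives [df (x, v)], and [df] is C^k on [U * E].  In finite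
   dimension this is ordinary C^k regularity.  [tvsType R] is the library's
   structure of locally convex topological vector spaces.  The functions are
   total, but their values outside [U] play no role. *)

Fixpoint Ck (R : realType) (k : nat) (E F : tvsType R) (U : set E)
    (f : E -> F) {struct k} : Prop :=
  (forall x, U x -> {for x, continuous f}) /\
  if k is k'.+1 then
    exists df : E * E -> F,
      (forall x v, U x ->
         h^-1 *: (f (x + h *: v) - f x) @[h --> (0 : R)^'] --> df (x, v)) /\
      @Ck R k' (E * E)%type F (U `*` setT) df
  else True.

Definition Cinfty (R : realType) (E F : tvsType R) (U : set E) (f : E -> F) :=
  forall k, Ck k U f.

(* A Hausdorff space with an atlas of charts [coord i : dom i -> model i]; the
   model spaces may vary with the chart.  By [coord_open] and [coord_inj] a
   chart is a homeomorphism of [dom i] onto an open subset of [model i]. *)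
Record manifold (R : realType) := Manifold {
  mpt :> topologicalType ;
  mpt_hausdorff : hausdorff_space mpt ;
  chart : Type ;
  model : chart -> tvsType R ;
  model_hausdorff : forall i, hausdorff_space (model i) ;
  dom : chart -> set mpt ;
  coord : forall i, mpt -> model i ;
  dom_open : forall i, open (dom i) ;
  dom_cover : forall x, exists i, dom i x ;
  coord_inj : forall i x y, dom i x -> dom i y -> coord i x = coord i y -> x = y ;
  coord_open : forall i (W : set mpt), W `<=` dom i ->
    (open W <-> open (coord i @` W)) ;
  coord_compat : forall i j, exists h : model i -> model j,
    Cinfty (coord i @` (dom i `&` dom j)) h /\
    forall x, dom i x -> dom j x -> coord j x = h (coord i x)
}.

Section SmoothMaps.
Variables (R : realType) (M N : manifold R).

(* The coordinate expression [h] of [f] is smooth near [x]; as [W] is open and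
   mapped into a chart domain, this includes continuity of [f] near [x]. *)
Definition smooth_at (f : M -> N) (x : M) :=
  forall (i : chart M) (j : chart N), dom i x -> dom j (f x) ->
  exists W : set M, [/\ open W, W x, W `<=` dom i, f @` W `<=` dom j &
    exists h : model i -> model j, Cinfty (coord i @` W) h /\
      forall y, W y -> coord j (f y) = h (coord i y)].

Definition smooth_on (V : set M) (f : M -> N) := forall x, V x -> smooth_at f x.

Definition smooth (f : M -> N) := smooth_on setT f.

End SmoothMaps.

(* Fibre products such as X^[2] and quotients such as D_(f,g) are handled
   through their functor of points: a [smooth_space] is a set together with
   the knowledge of which maps into it, from open subsets [V] of manifolds [T],
   are smooth.  (Such a map is given as a total function on [T], of which only
   the restriction to [V] matters.)  Below, [smooth_space]s are only ever built
   from manifolds by [mspace], [prod_space], [sub_space] and [quot_space]; when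
   the resulting set is a product manifold, a submanifold or a quotient
   manifold, its manifold structure has the same smooth maps. *)

Record smooth_space (R : realType) := SmoothSpace {
  spt :> Type ;
  plot : forall T : manifold R, set T -> (T -> spt) -> Prop
}.

Section SmoothSpaces.
Variable R : realType.

Definition mspace (M : manifold R) : smooth_space R :=
  @SmoothSpace R M (fun T V c => smooth_on V c).

Definition prod_space (A B : smooth_space R) : smooth_space R :=
  @SmoothSpace R (A * B)%type
    (fun T V c => plot V (fun t => (c t).1) /\ plot V (fun t => (c t).2)).

Definition sub_space (A : smooth_space R) (S : set A) : smooth_space R :=
  @SmoothSpace R {a : A | S a} (fun T V c => plot V (fun t => sval (c t))).

(* The points are the sets [r a], that is the equivalence classes when [r] is
   an equivalence relation; a map to the quotient is smooth when it lifts
   locally to a smooth map. *)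
Definition quot_space (A : smooth_space R) (r : A -> set A) : smooth_space R :=
  @SmoothSpace R {C : set A | exists a, C = r a}
    (fun T V c => forall t, V t ->
       exists W : set T, [/\ open W, W t, W `<=` V &
         exists c' : T -> A, plot W c' /\
           forall t', W t' -> sval (c t') (c' t')]).

Definition smooth_map (A B : smooth_space R) (f : A -> B) :=
  forall (T : manifold R) (V : set T) (c : T -> A),
    open V -> plot V c -> plot V (fun t => f (c t)).

Definition diffeomorphism (A B : smooth_space R) (f : A -> B) :=
  smooth_map f /\
  exists g : B -> A, [/\ smooth_map g, cancel f g & cancel g f].

(* The final topology of the smooth maps into [A]; for a manifold, or a
   submanifold of one, it is the manifold topology. *)
Definition sopen (A : smooth_space R) (W : set A) :=
  forall (T : manifold R) (V : set T) (c : T -> A),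
    open V -> plot V c -> open (V `&` c @^-1` W).

End SmoothSpaces.

Section Cstar.
Variable R : realType.

Definition Cstar : Type := {z : R[i] | z != 0}.

Definition Cstar1 : Cstar := exist _ 1 (oner_neq0 _).

Definition CstarM (z w : Cstar) : Cstar :=
  exist _ (sval z * sval w) (mulf_neq0 (svalP z) (svalP w)).

Definition Cstar_coord (z : Cstar) : R^o * R^o :=
  (complex.Re (sval z), complex.Im (sval z)).

Definition Cstar_top : topologicalType :=
  @initial_topology {z : R[i] | z != 0} (R^o * R^o)%type Cstar_coord.

Lemma Cstar_coord_inj : injective Cstar_coord.
Proof.
move=> [[a b] z0] [[c d] w0] [/= ac bd].
by apply: val_inj => /=; rewrite ac bd.
Qed.

Lemma Cstar_hausdorff : hausdorff_space Cstar_top.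
Proof.
move=> z w zw; apply: Cstar_coord_inj.
apply: (@norm_hausdorff R (R^o * R^o)%type) => A B nA nB.
have cf : continuous (Cstar_coord : Cstar_top -> R^o * R^o).
  exact: initial_continuous.
have [x [Ax Bx]] := zw _ _ (cf z A nA) (cf w B nB).
by exists (Cstar_coord x).
Qed.

Lemma RR_hausdorff : hausdorff_space (R^o * R^o)%type.
Proof. exact: norm_hausdorff. Qed.

Lemma Cstar_coord_range :
  range Cstar_coord = ~` [set (0, 0) : R^o * R^o].
Proof.
apply/seteqP; split=> [_ [[[a b] z0] _ <-] /= [a0 b0]|[a b] ab0].
  by move: z0; rewrite a0 b0 eqxx.
have z0 : Complex a b != 0.
  by apply/eqP => -[a0 b0]; apply: ab0; rewrite /= a0 b0.
by exists (exist (fun z : R[i] => z != 0) _ z0).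
Qed.

Lemma Cstar_coord_open (W : set Cstar_top) :
  W `<=` setT -> (open W <-> open (Cstar_coord @` W)).
Proof.
move=> _; split=> [[A oA <-]|oW].
  have -> : Cstar_coord @` (Cstar_coord @^-1` A) = A `&` range Cstar_coord.
    apply/seteqP; split=> [_ [z Az <-]|p [Ap [z _ zp]]].
      by split=> //; exists z.
    by exists z; rewrite /= ?zp.
  apply: openI => //; rewrite Cstar_coord_range; apply: closed_openC.
  by apply: accessible_closed_set1; apply: hausdorff_accessible;
    exact: RR_hausdorff.
exists (Cstar_coord @` W) => //; apply/seteqP; split=> [z [w Ww]|z Wz].
  by move/Cstar_coord_inj <-.
by exists z.
Qed.

Lemma Ck_linear k (E F : tvsType R) (U : set E) (f : E -> F) :
  (forall x h v, f (x + h *: v) = f x + h *: f v) -> continuous f -> Ck k U f.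
Proof.
elim: k E U f => [|k IHk] E U f lf cf; split=> //; try by move=> x _; exact: cf.
exists (f \o snd); split=> [x v _|].
  apply: cvg_near_cst; near=> h.
  have h0 : h != 0 by near: h; exact: nbhs_dnbhs_neq.
  by rewrite lf [f x + _]addrC addrK scalerA mulVf // scale1r.
apply: IHk => [x h v|x]; first exact: lf.
by apply: (continuous_comp (f := snd)); [exact: cvg_snd|exact: cf].
Unshelve. all: by end_near. Qed.

Lemma Cstar_compat (i j : unit) :
  exists h : R^o * R^o -> R^o * R^o,
    Cinfty (Cstar_coord @` (setT `&` setT)) h /\
    forall z : Cstar_top, setT z -> setT z -> Cstar_coord z = h (Cstar_coord z).
Proof.
exists id; split=> [k|//]; apply: Ck_linear => // x; exact: cvg_id.
Qed.

(* C^* as an open submanifold of C = R * R. *)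
Definition Cstar_mfd : manifold R :=
  @Manifold R Cstar_top Cstar_hausdorff unit (fun=> R^o * R^o)%type
    (fun=> RR_hausdorff) (fun=> setT) (fun=> Cstar_coord)
    (fun=> openT) (fun=> ex_intro _ tt I)
    (fun _ x y _ _ => @Cstar_coord_inj x y)
    (fun=> Cstar_coord_open) Cstar_compat.

End Cstar.

(* A principal C^*-bundle over [B]: [btriv] gives local trivialisations
   W * C^* -> p^-1(W), which are equivariant diffeomorphisms over [W]. *)
Record Cstar_bundle (R : realType) (B : smooth_space R) := CstarBundle {
  btot :> manifold R ;
  bproj : btot -> B ;
  bact : btot -> Cstar R -> btot ;
  bproj_smooth : smooth_map (A := mspace btot) bproj ;
  bact_smooth : smooth_map (A := prod_space (mspace btot) (mspace (Cstar_mfd R)))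
    (B := mspace btot) (fun uz => bact uz.1 uz.2) ;
  bact1 : forall u, bact u (Cstar1 R) = u ;
  bactM : forall u z w, bact (bact u z) w = bact u (CstarM z w) ;
  bproj_act : forall u z, bproj (bact u z) = bproj u ;
  btriv : forall b : B, exists W : set B, [/\ sopen W, W b &
    exists Phi : prod_space (sub_space W) (mspace (Cstar_mfd R)) ->
                 sub_space (A := mspace btot) (bproj @^-1` W),
    [/\ diffeomorphism Phi,
        forall b z, bproj (sval (Phi (b, z))) = sval b &
        forall b z w, sval (Phi (b, CstarM z w)) = bact (sval (Phi (b, z))) w]]
}.

Definition fibre_square (R : realType) (M X : manifold R) (pi : X -> M) :
    smooth_space R :=
  sub_space (A := prod_space (mspace X) (mspace X))
    [set xy | pi xy.1 = pi xy.2].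

(* [u] is an element of P_(src u, tgt u). *)
Definition src (R : realType) (M X : manifold R) (pi : X -> M)
  (P : Cstar_bundle (fibre_square pi)) (u : P) : X := (sval (bproj u)).1.
Definition tgt (R : realType) (M X : manifold R) (pi : X -> M)
  (P : Cstar_bundle (fibre_square pi)) (u : P) : X := (sval (bproj u)).2.

(* The pairs (u_23, u_12), i.e. the total space of the fibre product over X^[3]
   of pi_1^-1 P and pi_3^-1 P. *)
Definition composable (R : realType) (M X : manifold R) (pi : X -> M)
    (P : Cstar_bundle (fibre_square pi)) : smooth_space R :=
  sub_space (A := prod_space (mspace P) (mspace P))
    [set uv | src uv.1 = tgt uv.2].

(* [prod_is mu u v w] means that [v] and [u] are composable and [u v = w]. *)
Definition prod_is (R : realType) (M X : manifold R) (pi : X -> M)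
    (P : Cstar_bundle (fibre_square pi)) (mu : composable P -> P) (u v w : P) :=
  exists uv : composable P, sval uv = (u, v) /\ mu uv = w.

(* A smooth map that is balanced and equivariant ([gmul_actl], [gmul_actr]) is
   the same as a morphism of C^*-bundles out of the contracted product, and
   morphisms of C^*-bundles over the same base are isomorphisms. *)
Record bundle_gerbe (R : realType) (M : manifold R) := BundleGerbe {
  gX : manifold R ;
  gpi : gX -> M ;
  gpi_smooth : smooth gpi ;
  gpi_surj : forall m, exists x, gpi x = m ;
  gpi_section : forall m, exists U : set M, [/\ open U, U m &
    exists s : M -> gX, smooth_on U s /\ forall m', U m' -> gpi (s m') = m'] ;
  gP :> Cstar_bundle (fibre_square gpi) ;
  gmul : composable gP -> gP ;
  gmul_smooth : smooth_map (B := mspace gP) gmul ;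
  gmul_src : forall uv, src (gmul uv) = src (sval uv).2 ;
  gmul_tgt : forall uv, tgt (gmul uv) = tgt (sval uv).1 ;
  gmul_actl : forall u v w z, prod_is gmul u v w ->
    prod_is gmul (bact u z) v (bact w z) ;
  gmul_actr : forall u v w z, prod_is gmul u v w ->
    prod_is gmul u (bact v z) (bact w z) ;
  gmulA : forall u v w uv vw, prod_is gmul u v uv -> prod_is gmul v w vw ->
    exists uvw, prod_is gmul uv w uvw /\ prod_is gmul u vw uvw
}.

Section Gerbes.
Variables (R : realType) (M : manifold R).
Implicit Types P Q : bundle_gerbe M.

Definition gprod P (u v w : P) := prod_is (@gmul R M P) u v w.

(* [e] is the value at [x] of the identity section. *)
Definition gunit P (x : gX P) (e : P) :=
  [/\ src e = x, tgt e = x,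
      forall u : P, src u = x -> gprod u e u &
      forall u : P, tgt u = x -> gprod e u u].

Definition ginv P (u u' : P) :=
  exists e1 e2 : P, [/\ gunit (src u) e1, gunit (tgt u) e2,
    gprod u' u e1 & gprod u u' e2].

Record gerbe_morphism P Q := GerbeMorphism {
  gmap : gX P -> gX Q ;
  ghat : P -> Q ;
  gmap_smooth : smooth gmap ;
  gmap_pi : forall x, gpi (gmap x) = gpi x ;
  ghat_smooth : smooth ghat ;
  ghat_src : forall u, src (ghat u) = gmap (src u) ;
  ghat_tgt : forall u, tgt (ghat u) = gmap (tgt u) ;
  ghat_act : forall u z, ghat (bact u z) = bact (ghat u) z ;
  ghat_mul : forall u v w, gprod u v w -> gprod (ghat u) (ghat v) (ghat w)
}.

(* The total space of the bundle (f, g)^-1 Q on X. *)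
Definition Dhat P Q (f g : gerbe_morphism P Q) : smooth_space R :=
  sub_space (A := prod_space (mspace (gX P)) (mspace Q))
    [set xv | src xv.2 = gmap f xv.1 /\ tgt xv.2 = gmap g xv.1].

(* [d2] is the image of [d1] under the descent isomorphism of [Dhat f g]. *)
Definition descent P Q (f g : gerbe_morphism P Q) (d1 d2 : Dhat f g) : Prop :=
  exists (u u' : P) (a : Q), [/\ src u = (sval d1).1, tgt u = (sval d2).1,
    ginv u u', gprod (sval d1).2 (ghat f u') a &
    gprod (ghat g u) a (sval d2).2].

(* The total space of the bundle D_(f,g) on M. *)
Definition Dbundle P Q (f g : gerbe_morphism P Q) : smooth_space R :=
  quot_space (@descent P Q f g).

(* A point [c] of D_(f,g) lies over the point [m] of M. *)
Definition D_over P Q (f g : gerbe_morphism P Q) (c : Dbundle f g) (m : M) :=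
  forall d, sval c d -> gpi (sval d).1 = m.

Record transformation P Q (f g : gerbe_morphism P Q) := Transformation {
  tsec : M -> Dbundle f g ;
  tsec_smooth : smooth_map (A := mspace M) tsec ;
  tsec_over : forall m, D_over (tsec m) m
}.

Definition is_lift P Q (f g : gerbe_morphism P Q) (t : transformation f g)
    (th : gX P -> Q) :=
  smooth th /\
  forall x, exists d : Dhat f g,
    sval d = (x, th x) /\ sval (tsec t (gpi x)) d.

End Gerbes.

Definition cast2 (H : Type) (H2 : H -> H -> Type) (f f' g g' : H)
    (ef : f = f') (eg : g = g') (a : H2 f g) : H2 f' g' :=
  eq_rect f (fun k => H2 k g') (eq_rect g (fun k => H2 f k) a g' eg) f' ef.

Record two_category (Ob : Type) (Hom : Ob -> Ob -> Type)
    (Hom2 : forall A B : Ob, Hom A B -> Hom A B -> Type) := TwoCategory {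
  comp1 : forall A B C, Hom B C -> Hom A B -> Hom A C ;
  id1 : forall A, Hom A A ;
  vcomp : forall A B (f g h : Hom A B), Hom2 A B g h -> Hom2 A B f g -> Hom2 A B f h ;
  id2 : forall A B (f : Hom A B), Hom2 A B f f ;
  hcomp : forall A B C (f1 f2 : Hom A B) (g1 g2 : Hom B C),
    Hom2 B C g1 g2 -> Hom2 A B f1 f2 -> Hom2 A C (comp1 g1 f1) (comp1 g2 f2) ;
  comp1A : forall A B C D (h : Hom C D) (g : Hom B C) (f : Hom A B),
    comp1 (comp1 h g) f = comp1 h (comp1 g f) ;
  comp1_idl : forall A B (f : Hom A B), comp1 (id1 B) f = f ;
  comp1_idr : forall A B (f : Hom A B), comp1 f (id1 A) = f ;
  vcompA : forall A B (f g h k : Hom A B)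
    (c : Hom2 A B h k) (b : Hom2 A B g h) (a : Hom2 A B f g),
    vcomp (vcomp c b) a = vcomp c (vcomp b a) ;
  vcomp_idl : forall A B (f g : Hom A B) (a : Hom2 A B f g), vcomp (id2 g) a = a ;
  vcomp_idr : forall A B (f g : Hom A B) (a : Hom2 A B f g), vcomp a (id2 f) = a ;
  hcomp_id2 : forall A B C (g : Hom B C) (f : Hom A B),
    hcomp (id2 g) (id2 f) = id2 (comp1 g f) ;
  interchange : forall A B C (f1 f2 f3 : Hom A B) (g1 g2 g3 : Hom B C)
    (b' : Hom2 B C g2 g3) (b : Hom2 B C g1 g2)
    (a' : Hom2 A B f2 f3) (a : Hom2 A B f1 f2),
    hcomp (vcomp b' b) (vcomp a' a) = vcomp (hcomp b' a') (hcomp b a) ;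
  hcompA : forall A B C D (f1 f2 : Hom A B) (g1 g2 : Hom B C) (h1 h2 : Hom C D)
    (c : Hom2 C D h1 h2) (b : Hom2 B C g1 g2) (a : Hom2 A B f1 f2),
    cast2 (comp1A h1 g1 f1) (comp1A h2 g2 f2) (hcomp (hcomp c b) a) =
    hcomp c (hcomp b a) ;
  hcomp_idl : forall A B (f g : Hom A B) (a : Hom2 A B f g),
    cast2 (comp1_idl f) (comp1_idl g) (hcomp (id2 (id1 B)) a) = a ;
  hcomp_idr : forall A B (f g : Hom A B) (a : Hom2 A B f g),
    cast2 (comp1_idr f) (comp1_idr g) (hcomp a (id2 (id1 A))) = a
}.

(* Main.v *)
Require Import Defs.
From mathcomp Require Import all_boot all_order all_algebra.
From mathcomp Require Import all_classical all_reals all_analysis.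
From mathcomp Require Import complex ring.
(* [coord] is to mean the coordinates of a manifold, not those of a vector in a
   basis. *)
Import Defs.

(** A bundle gerbe is a groupoid: its objects are the points of [X], its arrows
    [x1 -> x2] are the elements of [P_(x1, x2)], and each set of arrows between
    two points of the same fibre is a [C^*]-torsor.  A bundle gerbe morphism is
    a functor, and a transformation, read on [X], is a natural transformation:
    it assigns to [x] an arrow [f x -> g x], and compatibility with descent is
    the naturality square.  The 2-category axioms are therefore those of
    categories, functors and natural transformations, checked pointwise; the
    content lies in the passage between sections of [D_(f,g)] and their lifts,
    and in smoothness.

    Lifts.  A class in [D_(f,g)] over [m] has exactly one representative over
    each [x] above [m] ([lift_ofP], [descent_any]), so a transformation has a
    unique lift and is determined by it ([transformation_eq]); conversely, a
    smooth natural family of arrows descends ([transformation_of_lift]).  All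
    operations on 2-arrows are defined on lifts, and every axiom becomes an
    identity between products of arrows.  Since composition of 1-arrows is
    composition of maps, associativity and units hold strictly, and transport
    along these equalities leaves lifts unchanged ([lift_cast2]).

    Smoothness.  The lift of a transformation and the identity section are both
    characterised by an equation [c a = b] with [a] and [b] smooth, and
    [smooth_division] says that the solution [c] is smooth: locally
    [c = c0 z] with [c0] a smooth section from a local trivialisation, and [z]
    is the ratio of two smooth sections of a [C^*]-bundle, hence smooth because
    division in [C^*] is.

    Calculus.  That smooth maps compose rests on the chain rule in locally
    convex spaces.  It follows from a mean value theorem with convex sets in the
    role of bounds ([mean_value]): the increment of a curve over a unit interval
    lies in every open convex set that contains all its derivatives.  So a
    difference quotient along moving directions is squeezed into an arbitrary
    convex neighbourhood of the derivative ([cvg_difference_quotient]). *)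

Set Implicit Arguments.
Unset Strict Implicit.
Unset Printing Implicit Defensive.
Import Order.TTheory GRing.Theory Num.Theory.
Import numFieldNormedType.Exports.
Local Open Scope ring_scope.
Local Open Scope classical_set_scope.

(** * Calculus in locally convex spaces *)

Section Calculus.
Variable R : realType.
Implicit Types E F G : tvsType R.

Definition is_convex (F : tvsType R) (D : set F) :=
  forall (y z : F) (t : R), 0 <= t -> t <= 1 -> D y -> D z ->
    D (t *: y + (1 - t) *: z).

Lemma convex_nbhs F (x : F) (A : set F) : nbhs x A ->
  exists D, [/\ open D, D x, D `<=` A & is_convex D].
Proof.
move=> nA; have [B cB [oB bB]] := @locally_convex R F.
have [D [BD Dx] DA] := bB x A nA.
exists D; split=> //; first exact: oB.
move=> y z t t0 t1 Dy Dz.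
have t01 : (0 <= t <= 1) by rewrite t0 t1.
have := cB D (mem_set BD) y z (Itv01 t0 t1) (mem_set Dy) (mem_set Dz).
by move=> /set_mem.
Qed.

(** The slope of a curve over [a, c] is a convex combination of its slopes over
    [a, b] and [b, c], with weights proportional to the lengths. *)
Lemma slope_join (F : lmodType R) (a b c : R) (x y z : F) : a < b -> b < c ->
  (c - a)^-1 *: (z - x) =
  ((b - a) / (c - a)) *: ((b - a)^-1 *: (y - x)) +
  (1 - (b - a) / (c - a)) *: ((c - b)^-1 *: (z - y)).
Proof.
move=> ab bc; have ac : a < c by exact: lt_trans bc.
have ba0 : b - a != 0 by rewrite subr_eq0 gt_eqF.
have cb0 : c - b != 0 by rewrite subr_eq0 gt_eqF.
have ca0 : c - a != 0 by rewrite subr_eq0 gt_eqF.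
rewrite !scalerA.
have -> : (b - a) / (c - a) / (b - a) = (c - a)^-1 by field; apply/andP.
have -> : (1 - (b - a) / (c - a)) / (c - b) = (c - a)^-1 by field; apply/andP.
by rewrite -scalerDr (addrC (y - x)) addrA subrK.
Qed.

(** Slopes over short intervals around [s] approach [g' s], so they lie in [D];
    by [slope_join] and convexity the slopes in [D] over adjacent intervals give
    a slope in [D] over their union, and the supremum of the [s] whose slope
    from 0 is in [D] can only be 1. *)
Lemma mean_value F (D : set F) (g g' : R -> F) :
  open D -> is_convex D ->
  (forall s, 0 <= s -> s <= 1 -> D (g' s) /\
     h^-1 *: (g (s + h) - g s) @[h --> (0 : R)^'] --> g' s) ->
  D (g 1 - g 0).
Proof.
move=> oD cD dg.
have join (a b c : R) : a < b -> b < c -> D ((b - a)^-1 *: (g b - g a)) ->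
    D ((c - b)^-1 *: (g c - g b)) -> D ((c - a)^-1 *: (g c - g a)).
  move=> ab bc Dab Dbc; rewrite (slope_join _ (g b) _ ab bc).
  have ca0 : 0 < c - a by rewrite subr_gt0 (lt_trans ab).
  apply: cD => //; first by rewrite divr_ge0 ?subr_ge0 ?ltW // (lt_trans ab).
  by rewrite ler_pdivrMr // mul1r lerD2r ltW.
have loc s : 0 <= s -> s <= 1 -> exists2 e, 0 < e & forall h, h != 0 ->
    `|h| < e -> D (h^-1 *: (g (s + h) - g s)).
  move=> s0 s1; have [Ds ds] := dg s s0 s1.
  have : nbhs (g' s) D by apply: open_nbhs_nbhs.
  move/ds; rewrite /= nbhs_simpl /= => -[e /= e0 eD].
  exists e => // h h0 he; apply: eD => //=.
  by rewrite sub0r normrN.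
pose A := [set s : R | [/\ 0 <= s, s <= 1 & s = 0 \/ D (s^-1 *: (g s - g 0))]].
have A0 : A 0 by split=> //; left.
have hA : has_sup A.
  by split; [exists 0|exists 1 => s []].
pose c := sup A.
have c0 : 0 <= c by exact: (ub_le_sup hA.2).
have c1 : c <= 1 by apply: ge_sup; [exists 0|move=> s []].
have extend (r s : R) : A r -> r < s -> s <= 1 ->
    D ((s - r)^-1 *: (g s - g r)) -> A s.
  move=> [r0 r1 Ar] rs s1 Drs; split=> //; first by rewrite (le_trans r0) ?ltW.
  right; have [r00|rn0] := eqVneq r 0; first by move: Drs; rewrite r00 subr0.
  case: Ar => [/eqP|Dr]; first by rewrite (negbTE rn0).
  rewrite -[s in s^-1]subr0; apply: (join 0 r s) => //; last by rewrite subr0.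
  by rewrite lt_neqAle eq_sym rn0.
have [e e0 De] := loc c c0 c1.
have Ac : A c.
  have [r Ar cer] := sup_adherent e0 hA.
  have rc : r <= c by exact: (ub_le_sup hA.2).
  move: rc; rewrite le_eqVlt => /predU1P[<-//|rc].
  apply: (extend r) => //.
  have := De (r - c); rewrite subr_eq0 lt_eqF // => /(_ isT).
  rewrite distrC ger0_norm ?subr_ge0 ?(ltW rc) // ltrBlDl -ltrBlDr => /(_ cer).
  rewrite (addrC c (r - c)) subrK -[r - c]opprB invrN scaleNr -scalerN.
  by rewrite opprB.
have [c1'|c1'] := eqVneq c 1.
  by case: Ac => _ _; rewrite c1' invr1 scale1r => -[/eqP|//]; rewrite oner_eq0.
have cl1 : c < 1 by rewrite lt_neqAle c1' c1.
pose s := Num.min 1 (c + e / 2).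
have e2 : 0 < e / 2 by rewrite divr_gt0.
have cs : c < s by rewrite lt_min cl1 ltrDl.
have : A s.
  apply: (extend c) => //; first by rewrite ge_min lexx.
  have := De (s - c); rewrite subr_eq0 gt_eqF // => /(_ isT).
  rewrite ger0_norm ?subr_ge0 ?(ltW cs) // (addrC c (s - c)) subrK; apply.
  rewrite ltrBlDl gt_min ltrD2l; apply/orP; right.
  by rewrite ltr_pdivrMr // mulr_natr mulr2n ltrDl.
by move=> As; have := ub_le_sup hA.2 As; rewrite leNgt cs.
Qed.

Lemma cvg_addscale E (y w : E) :
  (y + z.1 *: z.2) @[z --> ((0 : R^o), w)] --> y.
Proof.
have h : (y, z.1 *: z.2) @[z --> ((0 : R^o), w)] --> (y, (0 : E)).
  apply: cvg_pair => /=; first exact: cvg_cst.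
  by have := @scale_continuous _ E (0, w); rewrite /continuous_at /= scale0r.
by have := cvg_comp _ _ h (@add_continuous E (y, 0)); rewrite /= addr0.
Qed.

Lemma cvg_scaled_dnbhs (h : R) :
  h != 0 -> (k * h) @[k --> (0 : R)^'] --> (0 : R)^'.
Proof.
move=> h0 A [e /= e0 eA]; rewrite /= nbhs_simpl /=; near=> k.
apply: eA => /=; last by rewrite mulf_neq0 //; near: k; exact: nbhs_dnbhs_neq.
rewrite sub0r normrN normrM -ltr_pdivlMr ?normr_gt0 //.
near: k; apply: dnbhs0_lt; rewrite divr_gt0 ?normr_gt0 //.
Unshelve. all: by end_near. Qed.

(** The key step of the chain rule, where the direction [w_ h] varies with [h].
    The curve [s |-> h^-1 *: g (y + s h w_h)] on [0, 1] has this difference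
    quotient as its increment, and its derivatives are the values of [dg] at
    [(y + s h w_h, w_h)], which are all near [dg (y, w)] for small [h]. *)
Lemma cvg_difference_quotient E F (V : set E) (g : E -> F)
    (dg : E * E -> F) (y w : E) (w_ : R -> E) : open V -> V y ->
  (forall x v, V x ->
     h^-1 *: (g (x + h *: v) - g x) @[h --> (0 : R)^'] --> dg (x, v)) ->
  {for (y, w), continuous dg} ->
  w_ h @[h --> (0 : R)^'] --> w ->
  h^-1 *: (g (y + h *: w_ h) - g y) @[h --> (0 : R)^'] --> dg (y, w).
Proof.
move=> oV Vy dgP cdg cw A nA.
have [D [oD Dy DA cD]] := convex_nbhs nA.
have nD : nbhs (dg (y, w)) D by exact: open_nbhs_nbhs.
have nVD : \forall z \near ((0 : R^o), w),
    V (y + z.1 *: z.2) /\ D (dg (y + z.1 *: z.2, z.2)).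
  have cy := @cvg_addscale E y w; near=> z; split.
    by near: z; apply: cy; exact: open_nbhs_nbhs.
  near: z.
  have : (y + z.1 *: z.2, z.2) @[z --> ((0 : R^o), w)] --> (y, w).
    by apply: cvg_pair => //=; exact: cvg_snd.
  by move=> /(_ (dg @^-1` D)); apply; exact: cdg.
case: nVD => -[B C] /= [[e /= e0 eB] nC] BCP.
suff : \forall h \near (0 : R)^', D (h^-1 *: (g (y + h *: w_ h) - g y)).
  by rewrite /= nbhs_simpl; apply: filterS => h; exact: DA.
near=> h.
have h0 : h != 0 by near: h; exact: nbhs_dnbhs_neq.
have he : `|h| < e.
  near: h; apply: dnbhs0_lt => //.
have hC : C (w_ h) by near: h; exact: cw.
have seg s : 0 <= s -> s <= 1 ->
    V (y + (s * h) *: w_ h) /\ D (dg (y + (s * h) *: w_ h, w_ h)).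
  move=> s0 s1; apply: (BCP (s * h, w_ h)); split=> //=; apply: eB => /=.
  rewrite sub0r normrN normrM (le_lt_trans _ he) // ger0_norm //.
  by rewrite ler_piMl.
have := @mean_value F D (fun s => h^-1 *: g (y + (s * h) *: w_ h))
   (fun s => dg (y + (s * h) *: w_ h, w_ h)) oD cD.
rewrite mul1r mul0r scale0r addr0 -scalerBr; apply => s s0 s1.
have [Vs Ds] := seg s s0 s1; split=> //.
have kh := cvg_scaled_dnbhs h0.
have := cvg_comp _ _ kh (dgP _ (w_ h) Vs).
apply: cvg_trans; apply: near_eq_cvg; near=> k => /=.
rewrite -scalerBr scalerA mulrDl scalerDl addrA invrM ?unitfE //.
  by rewrite mulrC.
by near: k; exact: nbhs_dnbhs_neq.
Unshelve. all: by end_near. Qed.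

Lemma Ck_continuous k E F (U : set E) (f : E -> F) x :
  Ck k U f -> U x -> {for x, continuous f}.
Proof. by case: k => [|k] [cf _]; exact: cf. Qed.

Lemma Ck_sub k E F (U W : set E) (f : E -> F) :
  W `<=` U -> Ck k U f -> Ck k W f.
Proof.
elim: k E U W f => [|k IH] E U W f WU [cf df]; split=> //;
  try by move=> x /WU; exact: cf.
case: df => df [dfP Cdf]; exists df; split=> [x v /WU|]; first exact: dfP.
by apply: IH Cdf => -[x v] [/= /WU].
Qed.

Lemma Ck_pred k E F (U : set E) (f : E -> F) : Ck k.+1 U f -> Ck k U f.
Proof.
elim: k E U f => [|k IH] E U f [cf [df [dfP Cdf]]]; split=> //.
by exists df; split=> //; exact: IH.
Qed.

(** Precomposition with a linear map needs no chain rule: the derivative of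
    [f \o L] is [df \o (L * L)], again of the same form.  It serves in the
    general chain rule to see [f] as a function of the base point of a pair. *)
Lemma Ck_comp_linear k E E' F (U : set E) (V : set E') (L : E -> E')
    (f : E' -> F) :
  (forall x h v, L (x + h *: v) = L x + h *: L v) -> continuous L ->
  (forall x, U x -> V (L x)) -> Ck k V f -> Ck k U (f \o L).
Proof.
elim: k E E' U V L f => [|k IH] E E' U V L f lL cL UV [cf df]; split=> //;
  try by move=> x Ux; apply: continuous_comp; [exact: cL|exact/cf/UV].
case: df => df [dfP Cdf]; exists (df \o (fun p => (L p.1, L p.2))); split.
  by move=> x v Ux; under eq_fun do rewrite /= lL; exact/dfP/UV.
apply: (IH _ _ _ (V `*` setT)) Cdf => [x h v|x|[x v] [/= /UV]] //.
- by rewrite !lL.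
- by apply: cvg_pair; apply: continuous_comp;
    solve [exact: cL|exact: cvg_fst|exact: cvg_snd].
Qed.

Lemma Ck_pair k E F G (U : set E) (f : E -> F) (g : E -> G) :
  Ck k U f -> Ck k U g -> Ck k U (fun x => (f x, g x)).
Proof.
elim: k E U f g => [|k IH] E U f g [cf df] [cg dg]; split=> //;
  try by move=> x Ux; apply: cvg_pair; [exact: cf|exact: cg].
case: df => df [dfP Cdf]; case: dg => dg [dgP Cdg].
exists (fun p => (df p, dg p)); split; last exact: IH.
by move=> x v Ux; apply: cvg_pair; [exact: dfP|exact: dgP].
Qed.

Lemma open_setX (S T : topologicalType) (A : set S) (B : set T) :
  open A -> open B -> open (A `*` B).
Proof.
move=> oA oB; rewrite openE => -[x y] [/= Ax By].
by exists (A, B) => //; split; exact: open_nbhs_nbhs.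
Qed.

(** Induction on [k], the derivative [(x, v) |-> dg (f x, df (x, v))] being itself
    a composite of maps with one order of differentiability less. *)
Lemma Ck_comp k E F G (U : set E) (V : set F) (f : E -> F) (g : F -> G) :
  open V -> (forall x, U x -> V (f x)) ->
  Ck k U f -> Ck k V g -> Ck k U (g \o f).
Proof.
elim: k E F G U V f g => [|k IH] E F G U V f g oV UV Cf Cg; split=> //;
  try by move=> x Ux; apply: continuous_comp;
         [exact: (Ck_continuous Cf)|apply: (Ck_continuous Cg); exact: UV].
case: (Cf) => cf [df [dfP Cdf]]; case: (Cg) => cg [dg [dgP Cdg]].
exists (dg \o (fun p => (f p.1, df p))); split; last first.
  apply: (IH _ _ _ _ (V `*` setT) _ _ _ _ _ Cdg).
  - by apply: open_setX => //; exact: openT.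
  - by move=> [x v] [/= /UV].
  - apply: Ck_pair => //.
    apply: (Ck_comp_linear (V := U) (L := fst)) (Ck_pred Cf) => //.
    + by move=> x; exact: cvg_fst.
    + by move=> [x v] [].
move=> x v Ux /=.
have cd : {for (f x, df (x, v)), continuous dg}.
  by apply: (Ck_continuous Cdg); split => //; exact: UV.
have := cvg_difference_quotient oV (UV _ Ux) dgP cd (dfP x v Ux).
apply: cvg_trans; apply: near_eq_cvg; near=> h => /=.
rewrite scalerA divff ?scale1r; first by rewrite (addrC (f x)) subrK.
by near: h; exact: nbhs_dnbhs_neq.
Unshelve. all: by end_near. Qed.

Lemma Ck_cst k E F (U : set E) (c : F) : Ck k U (fun=> c).
Proof.
elim: k E U c => [|k IH] E U c; split=> //; try by move=> x _; exact: cvg_cst.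
exists (fun=> 0); split; last exact: IH.
by move=> x v _; under eq_fun do rewrite subrr scaler0; exact: cvg_cst.
Qed.

Lemma Ck_add k E F (U : set E) (f g : E -> F) :
  Ck k U f -> Ck k U g -> Ck k U (fun x => f x + g x).
Proof.
move=> Cf Cg.
apply: (Ck_comp (V := setT) (g := fun p : F * F => p.1 + p.2) openT _
  (Ck_pair Cf Cg)) => //.
apply: Ck_linear => [[a b] h [c d] /=|]; last exact: add_continuous.
by rewrite scalerDr addrACA.
Qed.

Lemma Ck_opp k E F (U : set E) (f : E -> F) :
  Ck k U f -> Ck k U (fun x => - f x).
Proof.
move=> Cf; apply: (Ck_comp (V := setT) (g := -%R) openT _ Cf) => //.
apply: Ck_linear => [a h b /=|]; last exact: opp_continuous.
by rewrite scalerN opprD.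
Qed.

Lemma continuous_mulR : continuous (fun p : R^o * R^o => (p.1 * p.2 : R^o)).
Proof. exact: (@scale_continuous R R^o). Qed.

Lemma continuous_dnbhs F (phi : R -> F) (l : F) :
  phi h @[h --> (0 : R)] --> l -> phi h @[h --> (0 : R)^'] --> l.
Proof. by apply: cvg_trans; apply: cvg_app; exact: nbhs_dnbhs. Qed.

Lemma fst_continuous (S T : topologicalType) : continuous (@fst S T).
Proof. by move=> x; exact: cvg_fst. Qed.

Lemma snd_continuous (S T : topologicalType) : continuous (@snd S T).
Proof. by move=> x; exact: cvg_snd. Qed.

Lemma pair_continuous (S T T' : topologicalType) (f : S -> T) (g : S -> T') :
  continuous f -> continuous g -> continuous (fun x => (f x, g x)).
Proof. by move=> cf cg x; apply: cvg_pair; [exact: cf|exact: cg]. Qed.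

Lemma affine_dnbhs (x v : R^o) : x + h * v @[h --> (0 : R)^'] --> x.
Proof.
apply: continuous_dnbhs.
have lim := cvgD (cvg_cst x) (@mulrr_continuous R v 0).
by rewrite /= mul0r addr0 in lim; exact: lim.
Qed.

Lemma Ck_mulR k (U : set (R^o * R^o)%type) :
  Ck k U (fun p : R^o * R^o => (p.1 * p.2 : R^o)).
Proof.
elim: k U => [|k IH] U; split=> //; try by move=> x _; exact: continuous_mulR.
exists (fun q : (R^o * R^o) * (R^o * R^o) => q.1.1 * q.2.2 + q.1.2 * q.2.1).
split.
  move=> [a b] [c d] _ /=.
  have lim : (a * d + b * c) + h * (c * d) @[h --> (0 : R)^'] --> a * d + b * c.
    exact: affine_dnbhs.
  apply: cvg_trans lim; apply: near_eq_cvg; near=> h => /=.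
  have h0 : h != 0 by near: h; exact: nbhs_dnbhs_neq.
  by rewrite /GRing.scale /=; field.
apply: Ck_add.
- apply: (Ck_comp_linear (V := setT) (f := fun p : R^o * R^o => (p.1 * p.2 : R^o))
    (L := fun q : (R^o * R^o) * (R^o * R^o) => (q.1.1, q.2.2))) (IH _) => //.
  apply: pair_continuous => x.
    exact: (continuous_comp (f := fst) (g := fst)
      (@fst_continuous _ _ _) (@fst_continuous _ _ _)).
  exact: (continuous_comp (f := snd) (g := snd)
      (@snd_continuous _ _ _) (@snd_continuous _ _ _)).
- apply: (Ck_comp_linear (V := setT) (f := fun p : R^o * R^o => (p.1 * p.2 : R^o))
    (L := fun q : (R^o * R^o) * (R^o * R^o) => (q.1.2, q.2.1))) (IH _) => //.
  apply: pair_continuous => x.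
    exact: (continuous_comp (f := fst) (g := snd)
      (@fst_continuous _ _ _) (@snd_continuous _ _ _)).
  exact: (continuous_comp (f := snd) (g := fst)
      (@snd_continuous _ _ _) (@fst_continuous _ _ _)).
Unshelve. all: by end_near. Qed.

Lemma Ck_mul k E (U : set E) (f g : E -> R^o) :
  Ck k U f -> Ck k U g -> Ck k U (fun x => f x * g x : R^o).
Proof.
move=> Cf Cg; exact: (Ck_comp (V := setT) openT _ (Ck_pair Cf Cg) (Ck_mulR k _)).
Qed.

(** Induction on [k]: the derivative [(x, v) |-> - x^-1 * x^-1 * v] is built from
    inversion and products. *)
Lemma Ck_inv k : Ck k [set x : R^o | x != 0] (GRing.inv : R^o -> R^o).
Proof.
elim: k => [|k IH]; split=> //; try by move=> x x0; exact: (@inv_continuous R).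
exists (fun q : R^o * R^o => - (q.1^-1 * q.1^-1 * q.2)); split.
  move=> x v /= x0.
  have lim : - ((x + h * v)^-1 * x^-1 * v) @[h --> (0 : R)^'] -->
      - (x^-1 * x^-1 * v).
    apply: cvgN; apply: cvgMr_tmp; apply: cvgMr_tmp; apply: cvgV => //.
    exact: affine_dnbhs.
  apply: cvg_trans lim; apply: near_eq_cvg; near=> h => /=.
  have h0 : h != 0 by near: h; exact: nbhs_dnbhs_neq.
  have xhv : x + h * v != 0.
    by near: h; apply: cvgr_neq0 x0; exact: affine_dnbhs.
  by rewrite /GRing.scale /=; field; rewrite x0 xhv h0.
have Cfst : Ck k ([set x : R^o | x != 0] `*` setT)
    (fun q : R^o * R^o => q.1^-1 : R^o).
  apply: (Ck_comp_linear (V := [set x : R^o | x != 0])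
    (f := GRing.inv : R^o -> R^o) (L := fst)) IH => //.
    exact: fst_continuous.
  by move=> [x v] [].
apply: Ck_opp; apply: Ck_mul; first exact: Ck_mul.
by apply: Ck_linear => //; exact: snd_continuous.
Unshelve. all: by end_near. Qed.

End Calculus.

(** * Smooth maps of manifolds and division in C^* *)

Section Manifolds.
Variable R : realType.
Implicit Types M N K T : manifold R.

(** Continuity of a map from that of one of its coordinate expressions: charts
    are open embeddings, and [coord j] is injective on its domain. *)
Lemma chart_open_preimage M N (f : M -> N) (i : chart M) (j : chart N)
    (W : set M) (A : set N) (h : model i -> model j) :
  open W -> W `<=` dom i -> (f @` W `<=` dom j) -> Cinfty (coord i @` W) h ->
  (forall y, W y -> coord j (f y) = h (coord i y)) ->
  open A -> A `<=` dom j -> open (W `&` f @^-1` A).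
Proof.
move=> oW Wi Wj Ch hE oA Aj.
have WAi : W `&` f @^-1` A `<=` dom i by move=> y [/Wi].
apply/(coord_open WAi).
have oW' : open (coord i @` W) by apply/(coord_open Wi).
have oA' : open (coord j @` A) by apply/(coord_open Aj).
rewrite openE => _ [y [Wy Ay] <-].
have nW : nbhs (coord i y) (coord i @` W).
  by apply: open_nbhs_nbhs; split=> //; exists y.
have nA : nbhs (h (coord i y)) (coord j @` A).
  by rewrite -hE //; apply: open_nbhs_nbhs; split=> //; exists (f y).
have ch : {for coord i y, continuous h}.
  have Wc : (coord i @` W) (coord i y) by exists y.
  exact: (Ck_continuous (Ch 0%N) Wc).
apply: filterS (filterI nW (ch _ nA)) => _ [[z Wz <-]] /= [b Ab bE].
exists z => //; split=> //=.
have -> : f z = b; last by [].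
apply: (@coord_inj _ _ j); [by apply: Wj; exists z|exact: Aj|].
by rewrite hE // bE.
Qed.

Lemma smooth_at_nbhs M N (f : M -> N) (x : M) (A : set N) :
  smooth_at f x -> open A -> A (f x) ->
  exists W, [/\ open W, W x & W `<=` f @^-1` A].
Proof.
move=> sf oA Afx.
have [i ix] := dom_cover x; have [j jx] := dom_cover (f x).
have [W [oW Wx Wi Wj [h [Ch hE]]]] := sf i j ix jx.
exists (W `&` f @^-1` (A `&` dom j)); split => //.
  apply: (chart_open_preimage oW Wi Wj Ch hE) => //.
  by apply: openI => //; exact: dom_open.
by move=> y [_ []].
Qed.

Lemma smooth_on_open M N (f : M -> N) (V : set M) (A : set N) :
  open V -> smooth_on V f -> open A -> open (V `&` f @^-1` A).
Proof.
move=> oV sf oA; rewrite openE => x [Vx Ax].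
have [W [oW Wx WA]] := smooth_at_nbhs (sf x Vx) oA Ax.
rewrite /interior /= nbhsE; exists (V `&` W); first by split; [exact: openI|].
by move=> y [Vy /WA].
Qed.

(** Only the middle chart can be chosen; the outer ones are those in which the
    composite is to be tested, as smoothness is required in all charts. *)
Lemma smooth_at_comp M N K (f : M -> N) (g : N -> K) x :
  smooth_at f x -> smooth_at g (f x) -> smooth_at (g \o f) x.
Proof.
move=> sf sg i k ix kx; have [j jx] := dom_cover (f x).
have [W [oW Wx Wi Wj [h [Ch hE]]]] := sf i j ix jx.
have [W' [oW' Wx' Wi' Wj' [h' [Ch' hE']]]] := sg j k jx kx.
exists (W `&` f @^-1` W'); split.
- exact: (chart_open_preimage oW Wi Wj Ch hE).
- by [].
- by move=> y [/Wi].
- by move=> _ [y [Wy Wy'] <-] /=; apply: Wj'; exists (f y).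
exists (h' \o h); split; last by move=> y [Wy Wy'] /=; rewrite hE' // hE.
move=> n; apply: (Ck_comp (V := coord j @` W')) (Ch' n).
- by apply/(coord_open Wi').
- by move=> _ [y [Wy Wy'] <-]; rewrite -hE //; exists (f y).
- by apply: Ck_sub (Ch n) => _ [y [Wy _] <-]; exists y.
Qed.

Lemma smooth_at_ext M N (f g : M -> N) (W : set M) x :
  open W -> W x -> (forall y, W y -> f y = g y) ->
  smooth_at f x -> smooth_at g x.
Proof.
move=> oW Wx fg sf i j ix; rewrite -(fg _ Wx) => jx.
have [W' [oW' Wx' Wi Wj [h [Ch hE]]]] := sf i j ix jx.
exists (W `&` W'); split=> //.
- exact: openI.
- by move=> y [_ /Wi].
- by move=> _ [y [Wy Wy'] <-]; rewrite -fg //; apply: Wj; exists y.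
exists h; split; last by move=> y [Wy Wy']; rewrite -fg // hE.
by move=> n; apply: Ck_sub (Ch n) => _ [y [_ Wy] <-]; exists y.
Qed.

Lemma smooth_id M : smooth (@id M).
Proof.
move=> x _ i j ix jx; have [h [Ch hE]] := @coord_compat R M i j.
exists (dom i `&` dom j); split=> //.
- by apply: openI; exact: dom_open.
- by move=> _ [y [_ ?] <-].

by exists h; split=> // y [] *; exact: hE.
Qed.

Lemma smooth_cst M N (c : N) : smooth (fun _ : M => c).
Proof.
move=> x _ i j ix jx; exists (dom i); split=> //.
- exact: dom_open.
- by move=> _ [y _ <-].
by exists (fun=> coord j c); split=> // n; exact: Ck_cst.
Qed.

Lemma smooth_on_comp M N K (f : M -> N) (g : N -> K) (V : set M) :
  smooth g -> smooth_on V f -> smooth_on V (g \o f).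
Proof. by move=> sg sf x Vx; apply: smooth_at_comp; [exact: sf|exact: sg]. Qed.

Lemma smooth_comp M N K (f : M -> N) (g : N -> K) :
  smooth f -> smooth g -> smooth (g \o f).
Proof. by move=> sf sg; exact: smooth_on_comp. Qed.

Lemma smooth_on_sub M N (f : M -> N) (V W : set M) :
  W `<=` V -> smooth_on V f -> smooth_on W f.
Proof. by move=> WV sf x /WV; exact: sf. Qed.

Lemma smooth_on_ext M N (f g : M -> N) (V : set M) :
  open V -> (forall y, V y -> f y = g y) -> smooth_on V f -> smooth_on V g.
Proof. by move=> oV fg sf x Vx; apply: (smooth_at_ext oV Vx fg); exact: sf. Qed.

Definition Cstar_div (z w : Cstar R) : Cstar R :=
  exist _ (sval z / sval w) (mulf_neq0 (svalP z) (invr_neq0 (svalP w))).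

Lemma CstarMdiv (z w : Cstar R) : CstarM w (Cstar_div z w) = z.
Proof. by apply: val_inj => /=; rewrite mulrCA divff ?mulr1 //; case: w. Qed.

Lemma CstarM_inj (z w w' : Cstar R) : CstarM z w = CstarM z w' -> w = w'.
Proof.
move=> /(congr1 sval) /= /mulfI e; apply: val_inj => /=; apply: e.
by case: z.
Qed.

Lemma Cstar_coord_div (z w : Cstar R) (p q : R^o * R^o) :
  Cstar_coord z = p -> Cstar_coord w = q ->
  q.1 * q.1 + q.2 * q.2 != 0 /\
  Cstar_coord (Cstar_div z w) =
   ((p.1 * q.1 + p.2 * q.2) * (q.1 * q.1 + q.2 * q.2)^-1,
    (p.2 * q.1 - p.1 * q.2) * (q.1 * q.1 + q.2 * q.2)^-1).
Proof.
move=> <- <-; case: z w => -[c d] z0 [[a b] w0] /=.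
have ab : a * a + b * b != 0.
  apply: contra w0 => /eqP e.
  have : a ^+ 2 + b ^+ 2 == 0 by rewrite !expr2 e.
  by rewrite paddr_eq0 ?sqr_ge0 // !sqrf_eq0 => /andP[/eqP -> /eqP ->].
split=> //; rewrite /Cstar_coord /=.
by rewrite !expr2; congr pair; field.
Qed.

Lemma smooth_at_Cstar_div T (z w : T -> Cstar_mfd R) x :
  smooth_at z x -> smooth_at w x ->
  smooth_at (N := Cstar_mfd R) (fun t => Cstar_div (z t) (w t)) x.
Proof.
move=> sz sw i j ix _.
have [W [oW Wx Wi _ [h [Ch hE]]]] := sz i tt ix I.
have [W' [oW' Wx' Wi' _ [h' [Ch' hE']]]] := sw i tt ix I.
exists (W `&` W'); split=> //.
- exact: openI.
- by move=> y [_ /Wi'].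
pose U := coord i @` (W `&` W').
pose n (p : model i) : R^o := (h' p).1 * (h' p).1 + (h' p).2 * (h' p).2.
exists (fun p => (((h p).1 * (h' p).1 + (h p).2 * (h' p).2) * (n p)^-1,
  ((h p).2 * (h' p).1 - (h p).1 * (h' p).2) * (n p)^-1)); split; last first.
  by move=> y [Wy Wy']; have [_] := Cstar_coord_div (hE _ Wy) (hE' _ Wy').
have n0 p : U p -> n p != 0.
  by move=> [y [Wy Wy'] <-]; have [] := Cstar_coord_div (hE _ Wy) (hE' _ Wy').
move=> k.
have C1 : Ck k U (fun p => (h p).1).
  apply: (Ck_comp (V := setT) (g := fst) openT) => //; last first.
    by apply: Ck_linear => //; exact: fst_continuous.
  by apply: Ck_sub (Ch k) => _ [y [? ?] <-]; exists y.
have C2 : Ck k U (fun p => (h p).2).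
  apply: (Ck_comp (V := setT) (g := snd) openT) => //; last first.
    by apply: Ck_linear => //; exact: snd_continuous.
  by apply: Ck_sub (Ch k) => _ [y [? ?] <-]; exists y.
have C1' : Ck k U (fun p => (h' p).1).
  apply: (Ck_comp (V := setT) (g := fst) openT) => //; last first.
    by apply: Ck_linear => //; exact: fst_continuous.
  by apply: Ck_sub (Ch' k) => _ [y [? ?] <-]; exists y.
have C2' : Ck k U (fun p => (h' p).2).
  apply: (Ck_comp (V := setT) (g := snd) openT) => //; last first.
    by apply: Ck_linear => //; exact: snd_continuous.
  by apply: Ck_sub (Ch' k) => _ [y [? ?] <-]; exists y.
have Cn : Ck k U (fun p => (n p)^-1 : R^o).
  apply: (Ck_comp (V := [set x : R^o | x != 0]) _ _ _ (@Ck_inv R k)) => //.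
  by apply: Ck_add; exact: Ck_mul.
apply: Ck_pair; apply: Ck_mul => //; apply: Ck_add; try (apply: Ck_opp);
  exact: Ck_mul.
Qed.

End Manifolds.

(** * Principal C^*-bundles *)

Section Bundles.
Variable R : realType.
Implicit Types (M T X : manifold R) (B : smooth_space R).

Lemma sig_inj (A : Type) (P : A -> Prop) : injective (@sval A P).
Proof.
move=> [x px] [y py] /= xy; case: _ / xy py => py.
by congr exist; exact: Prop_irrelevance.
Qed.

(** Plots are total functions, so a map that takes values in [S] only on an open
    set has to be given some value [a0] elsewhere to become a plot of [S]. *)
Definition to_subset (T A : Type) (S : set A) (a0 : {a | S a}) (c : T -> A)
    (t : T) : {a | S a} :=
  match pselect (S (c t)) with left H => exist _ (c t) H | right _ => a0 end.

Lemma to_subsetE (T A : Type) (S : set A) (a0 : {a | S a}) (c : T -> A)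
    (t : T) :
  S (c t) -> sval (to_subset a0 c t) = c t.
Proof. by rewrite /to_subset; case: pselect. Qed.

Lemma fibre_inhabited B (P : Cstar_bundle B) (b : B) :
  exists u : P, bproj u = b.
Proof.
have [W [_ Wb [Phi [_ pPhi _]]]] := btriv P b.
by exists (sval (Phi (exist _ b Wb, Cstar1 R))); rewrite pPhi.
Qed.

(** In a local trivialisation with inverse [g], the element of [C^*] that carries
    [u] to [v] is the ratio of their fibre coordinates. *)
Lemma btriv_coord B (P : Cstar_bundle B) (W : set B)
    (Phi : {b | W b} * Cstar R -> {v : P | W (bproj v)})
    (g : {v : P | W (bproj v)} -> {b | W b} * Cstar R) :
  cancel g Phi ->
  (forall b z, bproj (sval (Phi (b, z))) = sval b) ->
  (forall b z w, sval (Phi (b, CstarM z w)) = bact (sval (Phi (b, z))) w) ->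
  forall (u v : {v : P | W (bproj v)}), bproj (sval u) = bproj (sval v) ->
  sval v = bact (sval u) (Cstar_div (g v).2 (g u).2).
Proof.
move=> gK pPhi aPhi u v uv.
have bE : (g v).1 = (g u).1.
  apply: sig_inj; rewrite -(pPhi (g v).1 (g v).2) -(pPhi (g u).1 (g u).2).
  by rewrite -!surjective_pairing !gK.
have {1}-> : v = Phi ((g u).1, CstarM (g u).2 (Cstar_div (g v).2 (g u).2)).
  by rewrite CstarMdiv -bE -surjective_pairing gK.
by rewrite aPhi -surjective_pairing gK.
Qed.

Lemma fibre_transitive B (P : Cstar_bundle B) (u v : P) :
  bproj u = bproj v -> exists z, v = bact u z.
Proof.
move=> uv.
have [W [_ Wb [Phi [[_ [g [_ _ gK]]] pPhi aPhi]]]] := btriv P (bproj u).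
have Wv : W (bproj v) by rewrite -uv.
eexists.
exact: (btriv_coord gK pPhi aPhi (u := exist _ u Wb) (v := exist _ v Wv) uv).
Qed.

Lemma bact_inj B (P : Cstar_bundle B) (u : P) : injective (bact u).
Proof.
move=> z w zw.
have [W [_ Wb [Phi [[_ [g [_ PhiK gK]]] pPhi aPhi]]]] := btriv P (bproj u).
pose u' : {v : P | W (bproj v)} := exist _ u Wb.
have uE x : bact u x = sval (Phi ((g u').1, CstarM (g u').2 x)).
  by rewrite aPhi -surjective_pairing gK.
by move: zw; rewrite !uE => /sig_inj /(can_inj PhiK) /(congr1 snd) /CstarM_inj.
Qed.

(** By [btriv_coord] the ratio is, locally, a quotient in [C^*] of two smooth
    coordinates. *)
Lemma smooth_torsor_difference B (P : Cstar_bundle B) T (V : set T)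
    (u v : T -> P) (z : T -> Cstar_mfd R) :
  open V -> smooth_on V u -> smooth_on V v ->
  (forall t, V t -> v t = bact (u t) (z t)) -> smooth_on V z.
Proof.
move=> oV su sv vE t0 Vt0.
have [W [oW Wb [Phi [[_ [g [sg _ gK]]] pPhi aPhi]]]] := btriv P (bproj (u t0)).
pose V' := V `&` (fun t => bproj (u t)) @^-1` W.
have oV' : open V' by apply: (oW _ _ _ oV); exact: (bproj_smooth oV su).
have V't0 : V' t0 by [].
pose d : {v : P | W (bproj v)} := exist _ (u t0) Wb.
have V'v t : V' t -> W (bproj (v t)) by move=> [Vt Wt]; rewrite vE // bproj_act.
have su' : smooth_on V' (fun t => (g (to_subset d u t)).2).
  apply: (sg _ _ _ oV' _).2.
  apply: (smooth_on_ext oV' (f := u)); last by apply: smooth_on_sub su => t [].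
  by move=> t [_ Wt]; rewrite to_subsetE.
have sv' : smooth_on V' (fun t => (g (to_subset d v t)).2).
  apply: (sg _ _ _ oV' _).2.
  apply: (smooth_on_ext oV' (f := v)); last by apply: smooth_on_sub sv => t [].
  by move=> t /V'v Wt; rewrite to_subsetE.
apply: (smooth_at_ext oV' V't0 _
  (smooth_at_Cstar_div (sv' _ V't0) (su' _ V't0))).
move=> t V't; apply: (@bact_inj _ _ (u t)).
have [Vt Wt] := V't.
have := btriv_coord gK pPhi aPhi (u := to_subset d u t) (v := to_subset d v t).
rewrite !to_subsetE //; last exact: V'v.
by move=> <-; rewrite vE // bproj_act.
Qed.

(** The image of [1] under a local trivialisation is a section of [P], which is
    then pulled back along [(x, y)]. *)
Lemma local_section M X (pi : X -> M) (P : Cstar_bundle (fibre_square pi))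
    T (V : set T) (x y : T -> X) (t0 : T) :
  open V -> V t0 -> smooth_on V x -> smooth_on V y ->
  (forall t, V t -> pi (x t) = pi (y t)) ->
  exists W (u : T -> P), [/\ open W, W t0, W `<=` V, smooth_on W u &
    forall t, W t -> src (u t) = x t /\ tgt (u t) = y t].
Proof.
move=> oV Vt0 sx sy xy.
pose b0 : fibre_square pi := exist _ (x t0, y t0) (xy _ Vt0).
pose b : T -> fibre_square pi := to_subset b0 (fun t => (x t, y t)).
have bE t : V t -> sval (b t) = (x t, y t).
  by move=> Vt; rewrite to_subsetE //; apply: (xy t).
have pb : plot V b.
  split; [apply: (smooth_on_ext oV) sx|apply: (smooth_on_ext oV) sy] => t Vt;
    by rewrite bE.
have [W [oW Wb [Phi [[sPhi _] pPhi _]]]] := btriv P (b t0).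
pose V' := V `&` b @^-1` W.
have oV' : open V' by exact: oW.
pose d : {b | W b} := exist _ (b t0) Wb.
exists V', (fun t => sval (Phi (to_subset d b t, Cstar1 R))); split=> //.
- by move=> t [].
- apply: (sPhi _ _ _ oV'); split; last exact: smooth_on_sub (@smooth_cst _ _ _ _).
  have V'V : V' `<=` V by move=> t [].
  have dE t : V' t -> b t = sval (to_subset d b t).
    by move=> [_ Wt]; rewrite to_subsetE.
  split; [apply: (smooth_on_ext oV' _ (smooth_on_sub V'V pb.1))|
          apply: (smooth_on_ext oV' _ (smooth_on_sub V'V pb.2))] => t V't /=;
    by rewrite -dE.
- by move=> t [Vt Wt]; rewrite /src /tgt pPhi to_subsetE // bE.
Qed.

End Bundles.

(** * The groupoid of a bundle gerbe *)

Section Groupoid.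
Variables (R : realType) (M : manifold R) (Q : bundle_gerbe M).
Implicit Types (u v w : Q) (x y : gX Q) (z : Cstar R).

(** The product made total, so that identities between arrows can be proved by
    rewriting; the value on non-composable pairs is arbitrary. *)
Definition gmult u v : Q :=
  match pselect (src u = tgt v) with
  | left H => @gmul R M Q (exist _ (u, v) H)
  | right _ => u
  end.

Lemma gmul_gmult (uv : composable Q) : gmul uv = gmult (sval uv).1 (sval uv).2.
Proof.
rewrite /gmult; case: pselect => [H|]; last by case: uv.
by congr gmul; apply: sig_inj => /=; case: (sval uv).
Qed.

Lemma gprod_gmult u v : src u = tgt v -> gprod u v (gmult u v).
Proof. by move=> uv; exists (exist _ (u, v) uv); rewrite gmul_gmult. Qed.

Lemma gprodP u v w : gprod u v w <-> src u = tgt v /\ gmult u v = w.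
Proof.
split=> [[uv [e <-]]|[uv <-]]; last exact: gprod_gmult.
by rewrite gmul_gmult e; split=> //; have := svalP uv; rewrite /= e.
Qed.

Lemma src_gmult u v : src u = tgt v -> src (gmult u v) = src v.
Proof. by move=> uv; rewrite -(gmul_gmult (exist _ (u, v) uv)) gmul_src. Qed.

Lemma tgt_gmult u v : src u = tgt v -> tgt (gmult u v) = tgt u.
Proof. by move=> uv; rewrite -(gmul_gmult (exist _ (u, v) uv)) gmul_tgt. Qed.

Lemma gmultA u v w : src u = tgt v -> src v = tgt w ->
  gmult (gmult u v) w = gmult u (gmult v w).
Proof.
move=> uv vw; have [t [/gprodP[_ <-] /gprodP[_ <-]]] //:=
  gmulA (gprod_gmult uv) (gprod_gmult vw).
Qed.

Lemma src_act u z : src (bact u z) = src u.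
Proof. by rewrite /src bproj_act. Qed.

Lemma tgt_act u z : tgt (bact u z) = tgt u.
Proof. by rewrite /tgt bproj_act. Qed.

Lemma gmult_actl u v z :
  src u = tgt v -> gmult (bact u z) v = bact (gmult u v) z.
Proof. by move=> uv; have /gprodP[] := gmul_actl z (gprod_gmult uv). Qed.

Lemma gmult_actr u v z :
  src u = tgt v -> gmult u (bact v z) = bact (gmult u v) z.
Proof. by move=> uv; have /gprodP[] := gmul_actr z (gprod_gmult uv). Qed.

Lemma gpi_src u : gpi (src u) = gpi (tgt u).
Proof. by rewrite /src /tgt; case: (bproj u). Qed.

Lemma arrow_between x y : gpi x = gpi y -> exists u : Q, src u = x /\ tgt u = y.
Proof.
move=> xy; pose b : fibre_square (@gpi R M Q) := exist _ (x, y) xy.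
have [u uE] := fibre_inhabited Q b.
by exists u; rewrite /src /tgt uE.
Qed.

Lemma parallel_arrows u v : src u = src v -> tgt u = tgt v ->
  exists z, v = bact u z.
Proof.
rewrite /src /tgt => s t; apply: fibre_transitive; apply: sig_inj.
by rewrite [LHS]surjective_pairing s t -surjective_pairing.
Qed.

Lemma bact_id u z : bact u z = u -> z = Cstar1 R.
Proof. by rewrite -[in RHS](bact1 u) => /bact_inj. Qed.

(** Parallel arrows differ by a factor in [C^*], which the product carries along
    and which is read off from the result because the action is free. *)
Lemma gmult_injr u u' v : src u = tgt v -> src u' = src u -> tgt u' = tgt u ->
  gmult u v = gmult u' v -> u = u'.
Proof.
move=> uv /esym s /esym /(parallel_arrows s) [z ->] /esym.
by rewrite gmult_actl // => /bact_id ->; rewrite bact1.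
Qed.

Lemma gmult_injl u v v' : src u = tgt v -> src v' = src v -> tgt v' = tgt v ->
  gmult u v = gmult u v' -> v = v'.
Proof.
move=> uv /esym s /esym /(parallel_arrows s) [z ->] /esym.
by rewrite gmult_actr // => /bact_id ->; rewrite bact1.
Qed.

(** For any [e] in [P_(x,x)] one has [e = (e e) z] for some [z] in [C^*], and then
    [e z] is idempotent.  As arrows can be cancelled, an idempotent is the
    identity at [x]. *)
Lemma idempotent_arrow x :
  exists e : Q, [/\ src e = x, tgt e = x & gmult e e = e].
Proof.
have [e [s t]] := arrow_between (erefl (gpi x)).
have st : src e = tgt e by rewrite s t.
have [|//|z zE] := @parallel_arrows (gmult e e) e; first by rewrite src_gmult.
  by rewrite tgt_gmult.
exists (bact e z); rewrite src_act tgt_act; split=> //.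
by rewrite gmult_actl ?tgt_act // gmult_actr // -zE.
Qed.

Definition gid x : Q := sval (cid (idempotent_arrow x)).

Lemma src_gid x : src (gid x) = x.
Proof. by rewrite /gid; case: cid => e []. Qed.

Lemma tgt_gid x : tgt (gid x) = x.
Proof. by rewrite /gid; case: cid => e []. Qed.

Lemma gid_idem x : gmult (gid x) (gid x) = gid x.
Proof. by rewrite /gid; case: cid => e []. Qed.

Lemma gmult1r u x : src u = x -> gmult u (gid x) = u.
Proof.
move=> s; have st : src u = tgt (gid x) by rewrite tgt_gid.
apply: (@gmult_injr _ _ (gid x));
  rewrite ?src_gmult ?tgt_gmult ?src_gid ?tgt_gid //.
by rewrite gmultA ?src_gid ?tgt_gid // gid_idem.
Qed.

Lemma gmult1l u x : tgt u = x -> gmult (gid x) u = u.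
Proof.
move=> t; have st : src (gid x) = tgt u by rewrite src_gid.
apply: (@gmult_injl (gid x));
  rewrite ?src_gmult ?tgt_gmult ?src_gid ?tgt_gid //.
by rewrite -gmultA ?src_gid ?tgt_gid // gid_idem.
Qed.

Lemma gid_unique e : src e = tgt e -> gmult e e = e -> e = gid (src e).
Proof.
move=> st ee; apply: (@gmult_injl e); rewrite ?src_gid ?tgt_gid //.
by rewrite ee gmult1r.
Qed.

Lemma gunitP x e : gunit x e <-> e = gid x.
Proof.
split=> [[s t e1 _]|->].
  rewrite -s; apply: gid_unique; first by rewrite s t.
  by have /gprodP[] := e1 e s.
split; [exact: src_gid|exact: tgt_gid|move=> u ux|move=> u ux]; apply/gprodP.
  by rewrite tgt_gid gmult1r.
by rewrite src_gid gmult1l.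
Qed.

(** A left inverse is obtained by rescaling any arrow in the opposite direction;
    by cancellation it is also a right inverse. *)
Lemma inverse_arrow u : exists u' : Q, [/\ src u' = tgt u, tgt u' = src u,
  gmult u' u = gid (src u) & gmult u u' = gid (tgt u)].
Proof.
have [v [s t]] := arrow_between (esym (gpi_src u)).
have [||z zE] := @parallel_arrows (gmult v u) (gid (src u)).
- by rewrite src_gmult // src_gid.
- by rewrite tgt_gmult // tgt_gid.
exists (bact v z); rewrite src_act tgt_act; split=> //.
  by rewrite gmult_actl.
have st : src u = tgt (bact v z) by rewrite tgt_act.
apply: (@gmult_injr _ _ u);
  rewrite ?src_gmult ?tgt_gmult ?src_gid ?tgt_gid ?src_act //.
by rewrite gmultA ?src_act // gmult_actl // -zE gmult1r // gmult1l.
Qed.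

Lemma ginv_inverse u u' : src u' = tgt u -> tgt u' = src u ->
  gmult u' u = gid (src u) -> gmult u u' = gid (tgt u) -> ginv u u'.
Proof.
move=> s t e1 e2; exists (gid (src u)), (gid (tgt u)).
by split; [exact/gunitP|exact/gunitP|exact/gprodP|exact/gprodP].
Qed.

Lemma inverse_ginv u u' : ginv u u' -> [/\ src u' = tgt u, tgt u' = src u,
  gmult u' u = gid (src u) & gmult u u' = gid (tgt u)].
Proof.
by move=> [e1 [e2 [/gunitP -> /gunitP -> /gprodP[-> ->] /gprodP[-> ->]]]].
Qed.

Lemma smooth_tgt (T : manifold R) (V : set T) (c : T -> Q) :
  open V -> smooth_on V c -> smooth_on V (fun t => tgt (c t)).
Proof. by move=> oV sc; have [] := bproj_smooth oV sc. Qed.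

Lemma smooth_gmult (T : manifold R) (V : set T) (c d : T -> Q) :
  open V -> smooth_on V c -> smooth_on V d ->
  (forall t, V t -> src (c t) = tgt (d t)) ->
  smooth_on V (fun t => gmult (c t) (d t)).
Proof.
move=> oV sc sd cd t0 Vt0.
pose p0 : composable Q := exist _ (c t0, d t0) (cd _ Vt0).
pose p : T -> composable Q := to_subset p0 (fun t => (c t, d t)).
have pE t : V t -> sval (p t) = (c t, d t).
  by move=> Vt; rewrite to_subsetE //; apply: (cd t).
have sp : smooth_on V (fun t => gmul (p t)).
  apply: (gmul_smooth oV); split;
    [apply: (smooth_on_ext oV) sc|apply: (smooth_on_ext oV) sd] => t Vt;
    by rewrite pE.
apply: (smooth_on_ext oV _ sp Vt0) => t Vt.
by rewrite gmul_gmult pE.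
Qed.

(** Smoothness of [c = b a^-1].  Take a smooth local section [c0] with the
    endpoints of [c] and write [c = c0 z]; then [(c0 a) z = b], so that [z] is the
    ratio of two smooth sections.  This is where all the smoothness of lifts
    and of the identity section comes from. *)
Lemma smooth_division (T : manifold R) (V : set T) (a b c : T -> Q) :
  open V ->
  smooth_on V a -> smooth_on V b ->
  (forall t, V t -> src (c t) = tgt (a t) /\ gmult (c t) (a t) = b t) ->
  smooth_on V c.
Proof.
move=> oV sa sb ab t0 Vt0.
have tb t : V t -> tgt (c t) = tgt (b t).
  by move=> /ab[s <-]; rewrite tgt_gmult.
have ptab t : V t -> gpi (tgt (a t)) = gpi (tgt (b t)).
  by move=> Vt; have [<- _] := ab t Vt; rewrite gpi_src tb.
have [W [c0 [oW Wt0 WV sc0 c0E]]] :=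
  local_section Q oV Vt0 (smooth_tgt oV sa) (smooth_tgt oV sb) ptab.
have sW (N : manifold R) (f : T -> N) : smooth_on V f -> smooth_on W f.
  exact: smooth_on_sub.
have c0z t : exists z, W t -> c t = bact (c0 t) z.
  have [Wt|nW] := pselect (W t); last by exists (Cstar1 R).
  have [s' t'] := c0E t Wt.
  have [s _] := ab t (WV _ Wt).
  have [||z ->] := @parallel_arrows (c0 t) (c t); last by exists z.
    by rewrite s' s.
  by rewrite t' tb //; exact: WV.
have [z zE] := choice c0z.
have sz : smooth_on (N := Cstar_mfd R) W z.
  apply: (smooth_torsor_difference (P := Q)
    (u := fun t => gmult (c0 t) (a t)) (v := b) oW).
  - by apply: smooth_gmult (sW _ _ sa) _ => // t /c0E[].
  - exact: sW.
  - move=> t Wt; have [_ <-] := ab t (WV _ Wt).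
    by rewrite (zE _ Wt) gmult_actl //; have [] := c0E t Wt.
apply: (smooth_at_ext (f := fun t => bact (c0 t) (z t)) oW Wt0).
  by move=> t Wt; rewrite -zE.
exact: (@bact_smooth _ _ Q _ W (fun t => (c0 t, z t)) oW (conj sc0 sz) _ Wt0).
Qed.

(** The identity at [x] is the solution [c] of [c a = a], for [a] any smooth local
    section of [P] over the diagonal. *)
Lemma smooth_gid (T : manifold R) (V : set T) (x : T -> gX Q) : open V ->
  smooth_on V x -> smooth_on V (fun t => gid (x t)).
Proof.
move=> oV sx t0 Vt0.
have [W [a [oW Wt0 WV sa aE]]] :=
  local_section Q oV Vt0 sx sx (fun t _ => erefl).
apply: (smooth_division oW sa sa) Wt0 => t Wt.
by have [s t'] := aE t Wt; rewrite src_gid t' gmult1l.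
Qed.

End Groupoid.

(** * Transformations and their lifts *)

Section Lifts.
Variables (R : realType) (M : manifold R) (P Q : bundle_gerbe M).
Implicit Types f g : gerbe_morphism P Q.

Lemma ghat_gmult f (u v : P) : src u = tgt v ->
  ghat f (gmult u v) = gmult (ghat f u) (ghat f v).
Proof. by move=> /gprod_gmult/(ghat_mul f)/gprodP[]. Qed.

Lemma ghat_gid f (x : gX P) : ghat f (gid x) = gid (gmap f x).
Proof.
have <- : src (ghat f (gid x)) = gmap f x by rewrite ghat_src src_gid.
apply: gid_unique; first by rewrite ghat_src ghat_tgt src_gid tgt_gid.
by rewrite -ghat_gmult ?gid_idem // src_gid tgt_gid.
Qed.

Section Descent.
Variables f g : gerbe_morphism P Q.
Implicit Types (d : Dhat f g) (t : transformation f g).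

Lemma src_Dhat d : src (sval d).2 = gmap f (sval d).1.
Proof. by case: d => ? []. Qed.

Lemma tgt_Dhat d : tgt (sval d).2 = gmap g (sval d).1.
Proof. by case: d => ? []. Qed.

(** The descent isomorphism in the form of a naturality square, in which no
    inverse occurs. *)
Lemma descentP d1 d2 : descent d1 d2 <->
  exists u : P, [/\ src u = (sval d1).1, tgt u = (sval d2).1 &
    gmult (sval d2).2 (ghat f u) = gmult (ghat g u) (sval d1).2].
Proof.
split.
  move=> [u [u' [a [s t /inverse_ginv [s' t' e _]]]]].
  move=> /gprodP [c <-] /gprodP [c' <-].
  exists u; split=> //.
  rewrite gmultA // ?src_gmult // ?ghat_src ?ghat_tgt ?s' //.
  rewrite gmultA // ?ghat_src ?ghat_tgt ?s' // -ghat_gmult ?s' //.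
  by rewrite e ghat_gid s gmult1r ?src_Dhat.
move=> [u [s t e]]; have [u' [s' t' e1 e2]] := inverse_arrow u.
have c : src (sval d1).2 = tgt (ghat f u').
  by rewrite src_Dhat ghat_tgt t' s.
exists u, u', (gmult (sval d1).2 (ghat f u')); split=> //.
- exact: ginv_inverse.
- exact/gprodP.
apply/gprodP; split.
  by rewrite tgt_gmult // tgt_Dhat ghat_src s.
rewrite -gmultA // ?tgt_Dhat ?ghat_src ?s // -e gmultA.
- by rewrite -ghat_gmult ?t' // e2 ghat_gid t gmult1r // src_Dhat.
- by rewrite src_Dhat ghat_tgt t.
- by rewrite ghat_src ghat_tgt t'.
Qed.

(** Independence of the choice of [u]: two choices differ by a factor in [C^*],
    which scales both sides of the naturality square. *)
Lemma descent_any d1 d2 (u : P) : descent d1 d2 ->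
  src u = (sval d1).1 -> tgt u = (sval d2).1 ->
  gmult (sval d2).2 (ghat f u) = gmult (ghat g u) (sval d1).2.
Proof.
move=> /descentP[v [s0 t0 e]] s t.
have [||z ->] := @parallel_arrows _ _ _ v u; [by rewrite s|by rewrite t|].
rewrite !ghat_act gmult_actr ?src_Dhat ?ghat_tgt ?t0 //.
by rewrite gmult_actl ?tgt_Dhat ?ghat_src ?s0 // e.
Qed.

Lemma descent_refl d : descent d d.
Proof.
apply/descentP; exists (gid (sval d).1); rewrite src_gid tgt_gid; split=> //.
by rewrite !ghat_gid gmult1r ?gmult1l ?src_Dhat ?tgt_Dhat.
Qed.

Lemma descent_sym d1 d2 : descent d1 d2 -> descent d2 d1.
Proof.
move=> /descentP [u [s t e]]; have [u' [s' t' e1 e2]] := inverse_arrow u.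
apply/descentP; exists u'; rewrite s' t'; split=> //.
have -> : gmult (ghat g u') (sval d2).2 =
    gmult (ghat g u') (gmult (gmult (sval d2).2 (ghat f u)) (ghat f u')).
  rewrite gmultA ?src_Dhat ?ghat_src ?ghat_tgt ?t ?t' //.
  by rewrite -ghat_gmult ?t' // e2 ghat_gid t gmult1r // src_Dhat.
rewrite e gmultA ?src_Dhat ?tgt_Dhat ?ghat_src ?ghat_tgt ?t' ?s //.
rewrite -gmultA ?tgt_gmult ?src_Dhat ?tgt_Dhat ?ghat_src ?ghat_tgt ?s' ?s ?t' //
  ?s //.
rewrite -ghat_gmult ?s' // e1 ghat_gid gmult1l //.
by rewrite tgt_gmult ?src_Dhat ?ghat_tgt ?t' ?tgt_Dhat s.
Qed.

Lemma descent_trans d1 d2 d3 : descent d1 d2 -> descent d2 d3 -> descent d1 d3.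
Proof.
move=> /descentP [u [s t e]] /descentP [w [s' t' e']].
have wu : src w = tgt u by rewrite s' t.
apply/descentP; exists (gmult w u); rewrite src_gmult ?tgt_gmult //; split=> //.
rewrite !ghat_gmult // -gmultA ?src_Dhat ?ghat_src ?ghat_tgt ?t' ?wu //.
rewrite e' gmultA ?src_Dhat ?tgt_Dhat ?ghat_src ?ghat_tgt ?s' ?t //.
by rewrite e gmultA ?src_Dhat ?tgt_Dhat ?ghat_src ?ghat_tgt ?wu ?s.
Qed.

Lemma Dbundle_descent (C : Dbundle f g) d1 d2 :
  sval C d1 -> sval C d2 -> descent d1 d2.
Proof.
case: C => _ /= [a ->] h1 h2; exact: descent_trans (descent_sym h1) h2.
Qed.

Lemma Dbundle_eq (C1 C2 : Dbundle f g) d : sval C1 d -> sval C2 d -> C1 = C2.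
Proof.
move=> h1 h2; apply: sig_inj.
case: C1 C2 h1 h2 => _ /= [a ->] [_ /= [b ->]] /= h1 h2.
apply/seteqP; split=> c hc.
  exact: (descent_trans h2 (descent_trans (descent_sym h1) hc)).
exact: (descent_trans h1 (descent_trans (descent_sym h2) hc)).
Qed.

(** The lifts of transformations described intrinsically, as smooth natural
    transformations from the functor [f] to the functor [g]. *)
Record natural_lift (th : gX P -> Q) : Prop := NaturalLift {
  lift_smooth : smooth th ;
  lift_src : forall x, src (th x) = gmap f x ;
  lift_tgt : forall x, tgt (th x) = gmap g x ;
  lift_nat : forall u,
    gmult (th (tgt u)) (ghat f u) = gmult (ghat g u) (th (src u))
}.

(** A representative of the class at one point is transported to [x] along any
    arrow [u] of [P], as [g(u) v f(u)^-1]. *)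
Lemma lift_at_exists t (x : gX P) : exists v : Q, exists d : Dhat f g,
  sval d = (x, v) /\ sval (tsec t (gpi x)) d.
Proof.
have [a aE] := svalP (tsec t (gpi x)).
have ax : gpi (sval a).1 = gpi x.
  by apply: (tsec_over (t := t)); rewrite aE; exact: descent_refl.
have [u [s t']] := arrow_between ax.
have [u' [s2 t2 e1 e2]] := inverse_arrow u.
have c1 : src (ghat g u) = tgt (sval a).2 by rewrite ghat_src tgt_Dhat s.
have c2 : src (gmult (ghat g u) (sval a).2) = tgt (ghat f u').
  by rewrite src_gmult // ghat_tgt t2 src_Dhat s.
pose v := gmult (gmult (ghat g u) (sval a).2) (ghat f u').
have vD : src v = gmap f x /\ tgt v = gmap g x.
  by rewrite src_gmult // !tgt_gmult // ghat_src s2 ghat_tgt t'.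
exists v, (exist _ (x, v) vD : Dhat f g); split=> //; rewrite aE.
apply/descentP; exists u; split=> //=.
rewrite gmultA // ?ghat_src ?ghat_tgt ?s2 // -ghat_gmult ?s2 //.
rewrite e1 ghat_gid gmult1r //.
by rewrite src_gmult // src_Dhat s.
Qed.

Definition lift_of t (x : gX P) : Q := sval (cid (lift_at_exists t x)).

Lemma lift_ofP t x : exists d : Dhat f g,
  sval d = (x, lift_of t x) /\ sval (tsec t (gpi x)) d.
Proof. exact: svalP (cid (lift_at_exists t x)). Qed.

(** Smoothness: near [m] the section has a smooth representative [(s m, v m)], and
    for a smooth local section [u] of [P] over [(s (pi x), x)] the lift is the
    solution of [lift x f(u x) = g(u x) v(pi x)]. *)
Lemma natural_lift_of t : natural_lift (lift_of t).
Proof.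
have ls x : src (lift_of t x) = gmap f x.
  by have [d [e _]] := lift_ofP t x; have := src_Dhat d; rewrite e.
have lt x : tgt (lift_of t x) = gmap g x.
  by have [d [e _]] := lift_ofP t x; have := tgt_Dhat d; rewrite e.
split=> // [x0 _|u]; last first.
  have [d1 [e1 C1]] := lift_ofP t (src u).
  have [d2 [e2 C2]] := lift_ofP t (tgt u).
  rewrite gpi_src in C1.
  have := descent_any (u := u) (Dbundle_descent C1 C2).
  by rewrite e1 e2; apply.
have [W [oW Wx0 _ [c [[sc1 sc2] cE]]]] :=
  @tsec_smooth _ _ _ _ _ _ t M setT id openT (@smooth_id R M) (gpi x0) I.
have sV := smooth_on_open openT (gpi_smooth (b := P)) oW.
rewrite setTI in sV; set V := _ @^-1` W in sV.
have pre (N : manifold R) (h : M -> N) :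
    smooth_on W h -> smooth_on V (h \o @gpi R M P).
  by move=> sh x Vx; apply: smooth_at_comp (sh _ Vx); exact: gpi_smooth.
have sx := pre _ _ sc1; have sv := pre _ _ sc2.
have over x : V x -> gpi (sval (c (gpi x))).1 = gpi x.
  by move=> Vx; apply: (tsec_over (t := t)); exact: cE.
have [W' [u [oW' W'x0 W'V su uE]]] :=
  local_section P sV Wx0 sx
    (smooth_on_sub (@subsetT _ V) (@smooth_id R (gX P))) over.
have cu x : W' x -> src (ghat g (u x)) = tgt (sval (c (gpi x))).2.
  by move=> /uE[s _]; rewrite ghat_src tgt_Dhat s.
apply: (smooth_division oW' (a := ghat f \o u)
  (b := fun x => gmult (ghat g (u x)) (sval (c (gpi x))).2)) W'x0.
- exact: smooth_on_comp (@ghat_smooth _ _ _ _ f) su.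
- apply: smooth_gmult => //.
    exact: smooth_on_comp (@ghat_smooth _ _ _ _ g) su.
  exact: smooth_on_sub sv.
move=> x W'x; have [s' t'] := uE x W'x.
split; first by rewrite ls /= ghat_tgt t'.
have [d [e C]] := lift_ofP t x.
have := descent_any (u := u x) (Dbundle_descent (cE _ (W'V _ W'x)) C).
by rewrite e /=; apply.
Qed.

Lemma is_lift_of t : is_lift t (lift_of t).
Proof. split; [exact: lift_smooth (natural_lift_of t)|exact: lift_ofP]. Qed.

Lemma transformation_eq t1 t2 :
  (forall x, lift_of t1 x = lift_of t2 x) -> t1 = t2.
Proof.
move=> e; have {e} : tsec t1 = tsec t2.
  apply/funext => m; have [x <-] := gpi_surj P m.
  have [d1 [e1 C1]] := lift_ofP t1 x; have [d2 [e2 C2]] := lift_ofP t2 x.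
  apply: (Dbundle_eq C1).
  by rewrite (_ : d1 = d2) //; apply: sig_inj; rewrite e1 e2 e.
case: t1 t2 => [s1 a1 b1] [s2 a2 b2] /= s12; case: _ / s12 a2 b2 => a2 b2.
by congr Transformation; exact: Prop_irrelevance.
Qed.

Section FromLift.
Variables (th : gX P -> Q) (thN : natural_lift th).

Definition lift_point (x : gX P) : Dhat f g :=
  exist _ (x, th x) (conj (lift_src thN x) (lift_tgt thN x)).

Lemma descent_lift_point x y : gpi x = gpi y ->
  descent (lift_point x) (lift_point y).
Proof.
move=> /arrow_between[u [s t]]; apply/descentP; exists u; split=> //=.
by rewrite -s -t (lift_nat thN).
Qed.

Definition point_over (m : M) : gX P := sval (cid (gpi_surj P m)).

Lemma gpi_point_over m : gpi (point_over m) = m.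
Proof. exact: svalP (cid (gpi_surj P m)). Qed.

Definition lift_section (m : M) : Dbundle f g :=
  exist _ (@descent R M P Q f g (lift_point (point_over m)))
    (ex_intro _ _ erefl).

(** The class of [lift_point x] depends on [gpi x] only, so near any point it can
    be computed with a smooth local section in place of [point_over]. *)
Lemma lift_section_smooth : smooth_map (A := mspace M) lift_section.
Proof.
move=> T V c oV sc t Vt.
have [U [oU Uc [s [ss sE]]]] := gpi_section P (c t).
pose W := V `&` c @^-1` U.
have oW : open W by exact: (smooth_on_open oV sc oU).
exists W; split=> //; first by move=> t' [].
have sW : smooth_on W (s \o c).
  by move=> t' [Vt' Ut']; apply: smooth_at_comp; [exact: sc|exact: ss].
exists (fun r => lift_point (s (c r))); split.
  split=> //.
  exact: smooth_on_comp (lift_smooth thN) sW.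
move=> t' [Vt' Ut'] /=; apply: descent_lift_point.
by rewrite gpi_point_over sE.
Qed.

Lemma lift_section_over m : D_over (lift_section m) m.
Proof.
move=> d /descentP[u [s t _]].
by rewrite -t -gpi_src s /= gpi_point_over.
Qed.

Definition transformation_of_lift : transformation f g :=
  Transformation lift_section_smooth lift_section_over.

Lemma lift_of_transformation_of_lift x :
  lift_of transformation_of_lift x = th x.
Proof.
have [d [e C]] := lift_ofP transformation_of_lift x.
have C' : sval (tsec transformation_of_lift (gpi x)) (lift_point x).
  by apply: descent_lift_point; rewrite gpi_point_over.
have := descent_any (u := gid x) (Dbundle_descent C' C).
rewrite e /= src_gid tgt_gid !ghat_gid gmult1r ?gmult1l ?(lift_tgt thN) //.
  by apply.
exact: (lift_src (natural_lift_of transformation_of_lift)).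
Qed.

End FromLift.
End Descent.
End Lifts.

(** * The 2-category of bundle gerbes *)

Section TwoCategory.
Variables (R : realType) (M : manifold R).
Implicit Types P Q S : bundle_gerbe M.

Lemma gerbe_morphism_eq P Q (f g : gerbe_morphism P Q) :
  gmap f = gmap g -> ghat f = ghat g -> f = g.
Proof.
case: f g => [m h a1 a2 a3 a4 a5 a6 a7] [m' h' b1 b2 b3 b4 b5 b6 b7] /= mE hE.
case: _ / mE b1 b2 b4 b5 => b1 b2 b4 b5.
case: _ / hE b3 b4 b5 b6 b7 => b3 b4 b5 b6 b7.
by congr GerbeMorphism; exact: Prop_irrelevance.
Qed.

Definition gerbe_id P : gerbe_morphism P P.
Proof.
by refine (@GerbeMorphism R M P P id id _ _ _ _ _ _ _) => //; exact: smooth_id.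
Defined.

Definition gerbe_comp P Q S (g : gerbe_morphism Q S) (f : gerbe_morphism P Q) :
  gerbe_morphism P S.
Proof.
refine (@GerbeMorphism R M P S (gmap g \o gmap f) (ghat g \o ghat f)
  _ _ _ _ _ _ _).
- exact: smooth_comp (@gmap_smooth _ _ _ _ f) (@gmap_smooth _ _ _ _ g).
- by move=> x /=; rewrite !gmap_pi.
- exact: smooth_comp (@ghat_smooth _ _ _ _ f) (@ghat_smooth _ _ _ _ g).
- by move=> u /=; rewrite !ghat_src.
- by move=> u /=; rewrite !ghat_tgt.
- by move=> u z /=; rewrite !ghat_act.
- by move=> u v w uvw; apply/ghat_mul/ghat_mul.
Defined.

Lemma gerbe_compA P Q S S' (h : gerbe_morphism S S') (g : gerbe_morphism Q S)
    (f : gerbe_morphism P Q) :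
  gerbe_comp (gerbe_comp h g) f = gerbe_comp h (gerbe_comp g f).
Proof. exact: gerbe_morphism_eq. Qed.

Lemma gerbe_comp_idl P Q (f : gerbe_morphism P Q) :
  gerbe_comp (gerbe_id Q) f = f.
Proof. exact: gerbe_morphism_eq. Qed.

Lemma gerbe_comp_idr P Q (f : gerbe_morphism P Q) :
  gerbe_comp f (gerbe_id P) = f.
Proof. exact: gerbe_morphism_eq. Qed.

Lemma natural_lift_comp P Q (f g h : gerbe_morphism P Q) (a b : gX P -> Q) :
  natural_lift g h b -> natural_lift f g a ->
  natural_lift f h (fun x => gmult (b x) (a x)).
Proof.
move=> [sb bs bt bN] [sa as_ at_ aN].
have ba x : src (b x) = tgt (a x) by rewrite bs at_.
split=> [|x|x|u].
- by apply: (smooth_gmult openT) => // x _; exact: ba.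
- by rewrite src_gmult.
- by rewrite tgt_gmult.
rewrite gmultA // ?as_ ?ghat_tgt // aN.
rewrite -gmultA // ?bs ?ghat_tgt ?ghat_src ?at_ //.
by rewrite bN gmultA // ghat_src bt.
Qed.

Lemma natural_lift_id P Q (f : gerbe_morphism P Q) :
  natural_lift f f (fun x => gid (gmap f x)).
Proof.
split=> [|x|x|u].
- exact: (smooth_gid openT (@gmap_smooth _ _ _ _ f)).
- exact: src_gid.
- exact: tgt_gid.
by rewrite gmult1l ?ghat_tgt // gmult1r // ghat_src.
Qed.

(** The square of the composite is pasted from that of [b] at [f1 u] and the
    image under [g2] of that of [a] at [u]. *)
Lemma natural_lift_hcomp P Q S (f1 f2 : gerbe_morphism P Q)
    (g1 g2 : gerbe_morphism Q S) (b : gX Q -> S) (a : gX P -> Q) :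
  natural_lift g1 g2 b -> natural_lift f1 f2 a ->
  natural_lift (gerbe_comp g1 f1) (gerbe_comp g2 f2)
    (fun x => gmult (ghat g2 (a x)) (b (gmap f1 x))).
Proof.
move=> [sb bs bt bN] [sa as_ at_ aN].
have ab x : src (ghat g2 (a x)) = tgt (b (gmap f1 x)).
  by rewrite ghat_src as_ bt.
split=> [|x|x|u].
- apply: (smooth_gmult openT).
    exact: smooth_comp sa (@ghat_smooth _ _ _ _ g2).
    exact: smooth_comp (@gmap_smooth _ _ _ _ f1) sb.
  by move=> x _; exact: ab.
- by rewrite src_gmult // bs.
- by rewrite tgt_gmult // ghat_tgt at_.
have c1 : src (a (tgt u)) = tgt (ghat f1 u) by rewrite as_ ghat_tgt.
have c2 : src (ghat f2 u) = tgt (a (src u)) by rewrite at_ ghat_src.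
have c3 : src (b (gmap f1 (tgt u))) = tgt (ghat g1 (ghat f1 u)).
  by rewrite bs !ghat_tgt.
have c4 : src (ghat g2 (a (tgt u))) = tgt (ghat g2 (ghat f1 u)).
  by rewrite ghat_src ghat_tgt c1.
have c5 : src (ghat g2 (ghat f1 u)) = tgt (b (gmap f1 (src u))).
  by rewrite !ghat_src bt.
have c6 : src (ghat g2 (ghat f2 u)) = tgt (ghat g2 (a (src u))).
  by rewrite ghat_src ghat_tgt c2.
rewrite /= (gmultA (ab _) c3).
have := bN (ghat f1 u); rewrite ghat_tgt ghat_src => ->.
by rewrite -(gmultA c4 c5) -ghat_gmult // aN ghat_gmult // gmultA.
Qed.

Definition vertical_comp P Q (f g h : gerbe_morphism P Q)
    (l : transformation g h) (t : transformation f g) : transformation f h :=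
  transformation_of_lift (natural_lift_comp (natural_lift_of l) (natural_lift_of t)).

Definition identity2 P Q (f : gerbe_morphism P Q) : transformation f f :=
  transformation_of_lift (natural_lift_id f).

Definition horizontal_comp P Q S (f1 f2 : gerbe_morphism P Q)
    (g1 g2 : gerbe_morphism Q S) (l : transformation g1 g2)
    (t : transformation f1 f2) :
    transformation (gerbe_comp g1 f1) (gerbe_comp g2 f2) :=
  transformation_of_lift (natural_lift_hcomp (natural_lift_of l) (natural_lift_of t)).

Lemma lift_vertical_comp P Q (f g h : gerbe_morphism P Q)
    (l : transformation g h) (t : transformation f g) x :
  lift_of (vertical_comp l t) x = gmult (lift_of l x) (lift_of t x).
Proof. exact: lift_of_transformation_of_lift. Qed.

Lemma lift_identity2 P Q (f : gerbe_morphism P Q) x :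
  lift_of (identity2 f) x = gid (gmap f x).
Proof. exact: lift_of_transformation_of_lift. Qed.

Lemma lift_horizontal_comp P Q S (f1 f2 : gerbe_morphism P Q)
    (g1 g2 : gerbe_morphism Q S) (l : transformation g1 g2)
    (t : transformation f1 f2) x :
  lift_of (horizontal_comp l t) x =
  gmult (ghat g2 (lift_of t x)) (lift_of l (gmap f1 x)).
Proof. exact: lift_of_transformation_of_lift. Qed.

(** The type of lifts does not depend on the two morphisms, so the casts in the
    associativity and unit axioms are invisible on lifts. *)
Lemma lift_cast2 P Q (f f' g g' : gerbe_morphism P Q)
    (ef : f = f') (eg : g = g') (t : transformation f g) x :
  lift_of (cast2 (H2 := @transformation R M P Q) ef eg t) x = lift_of t x.
Proof. by case: _ / ef; case: _ / eg. Qed.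

Lemma src_lift P Q (f g : gerbe_morphism P Q) (t : transformation f g) x :
  src (lift_of t x) = gmap f x.
Proof. exact: lift_src (natural_lift_of t) x. Qed.

Lemma tgt_lift P Q (f g : gerbe_morphism P Q) (t : transformation f g) x :
  tgt (lift_of t x) = gmap g x.
Proof. exact: lift_tgt (natural_lift_of t) x. Qed.

Lemma lift_natural P Q (f g : gerbe_morphism P Q) (t : transformation f g) u :
  gmult (lift_of t (tgt u)) (ghat f u) = gmult (ghat g u) (lift_of t (src u)).
Proof. exact: lift_nat (natural_lift_of t) u. Qed.

Lemma vertical_assoc P Q (f g h k : gerbe_morphism P Q) (c : transformation h k)
    (b : transformation g h) (a : transformation f g) :
  vertical_comp (vertical_comp c b) a = vertical_comp c (vertical_comp b a).
Proof.
apply: transformation_eq => x.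
by rewrite !lift_vertical_comp gmultA ?src_lift ?tgt_lift.
Qed.

Lemma vertical_idl P Q (f g : gerbe_morphism P Q) (a : transformation f g) :
  vertical_comp (identity2 g) a = a.
Proof.
apply: transformation_eq => x.
by rewrite lift_vertical_comp lift_identity2 gmult1l ?tgt_lift.
Qed.

Lemma vertical_idr P Q (f g : gerbe_morphism P Q) (a : transformation f g) :
  vertical_comp a (identity2 f) = a.
Proof.
apply: transformation_eq => x.
by rewrite lift_vertical_comp lift_identity2 gmult1r ?src_lift.
Qed.

Lemma horizontal_id P Q S (g : gerbe_morphism Q S) (f : gerbe_morphism P Q) :
  horizontal_comp (identity2 g) (identity2 f) = identity2 (gerbe_comp g f).
Proof.
apply: transformation_eq => x.
by rewrite lift_horizontal_comp !lift_identity2 ghat_gid gmult1r // src_gid.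
Qed.

(** The interchange law: after cancelling the outer factors it is the naturality
    square of [b'] at the arrow [a x]. *)
Lemma horizontal_vertical P Q S (f1 f2 f3 : gerbe_morphism P Q)
    (g1 g2 g3 : gerbe_morphism Q S)
    (b' : transformation g2 g3) (b : transformation g1 g2)
    (a' : transformation f2 f3) (a : transformation f1 f2) :
  horizontal_comp (vertical_comp b' b) (vertical_comp a' a) =
  vertical_comp (horizontal_comp b' a') (horizontal_comp b a).
Proof.
apply: transformation_eq => x.
rewrite lift_horizontal_comp !lift_vertical_comp !lift_horizontal_comp.
have ac : src (lift_of a' x) = tgt (lift_of a x) by rewrite src_lift tgt_lift.
rewrite ghat_gmult //.
have := lift_natural b' (lift_of a x); rewrite src_lift tgt_lift => nat.
have c1 : src (lift_of b' (gmap f2 x)) = tgt (ghat g2 (lift_of a x)).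
  by rewrite src_lift ghat_tgt tgt_lift.
have c2 : src (ghat g2 (lift_of a x)) = tgt (lift_of b (gmap f1 x)).
  by rewrite ghat_src src_lift tgt_lift.
have c3 : src (ghat g3 (lift_of a' x)) = tgt (lift_of b' (gmap f2 x)).
  by rewrite ghat_src !src_lift tgt_lift.
have c4 : src (lift_of b' (gmap f1 x)) = tgt (lift_of b (gmap f1 x)).
  by rewrite src_lift tgt_lift.
have c5 : src (ghat g3 (lift_of a x)) = tgt (lift_of b' (gmap f1 x)).
  by rewrite ghat_src src_lift tgt_lift.
have c6 : src (ghat g3 (lift_of a' x)) = tgt (ghat g3 (lift_of a x)).
  by rewrite ghat_src ghat_tgt ac.
rewrite [RHS]gmultA ?tgt_gmult //.
rewrite -[in RHS](gmultA c1 c2) nat (gmultA c5 c4).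
by rewrite gmultA // ?tgt_gmult.
Qed.

Lemma horizontal_assoc P Q S S' (f1 f2 : gerbe_morphism P Q)
    (g1 g2 : gerbe_morphism Q S) (h1 h2 : gerbe_morphism S S')
    (c : transformation h1 h2) (b : transformation g1 g2)
    (a : transformation f1 f2) :
  cast2 (H2 := @transformation R M P S')
    (gerbe_compA h1 g1 f1) (gerbe_compA h2 g2 f2)
    (horizontal_comp (horizontal_comp c b) a) =
  horizontal_comp c (horizontal_comp b a).
Proof.
apply: transformation_eq => x; rewrite lift_cast2 !lift_horizontal_comp /=.
have cb : src (ghat g2 (lift_of a x)) = tgt (lift_of b (gmap f1 x)).
  by rewrite ghat_src src_lift tgt_lift.
rewrite ghat_gmult // gmultA //.
- by rewrite !ghat_src ghat_tgt src_lift tgt_lift.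
- by rewrite ghat_src src_lift tgt_lift.
Qed.

Lemma horizontal_idl P Q (f g : gerbe_morphism P Q) (a : transformation f g) :
  cast2 (H2 := @transformation R M P Q) (gerbe_comp_idl f) (gerbe_comp_idl g)
    (horizontal_comp (identity2 (gerbe_id Q)) a) = a.
Proof.
apply: transformation_eq => x.
rewrite lift_cast2 lift_horizontal_comp lift_identity2.
by rewrite gmult1r //= src_lift.
Qed.

Lemma horizontal_idr P Q (f g : gerbe_morphism P Q) (a : transformation f g) :
  cast2 (H2 := @transformation R M P Q) (gerbe_comp_idr f) (gerbe_comp_idr g)
    (horizontal_comp a (identity2 (gerbe_id P))) = a.
Proof.
apply: transformation_eq => x.
rewrite lift_cast2 lift_horizontal_comp lift_identity2.
by rewrite ghat_gid gmult1l // tgt_lift.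
Qed.

Definition BGrb : two_category (@transformation R M) :=
  TwoCategory vertical_assoc vertical_idl vertical_idr horizontal_id
    horizontal_vertical horizontal_assoc horizontal_idl horizontal_idr.

End TwoCategory.
Theorem proposition4p4 (R : realType) (M : manifold R) :
  exists BGrb : two_category (@transformation R M),
    (* composition of 1-arrows and identity 1-arrows *)
    (forall (P Q S : bundle_gerbe M)
        (g : gerbe_morphism Q S) (f : gerbe_morphism P Q),
      (forall x : gX P, gmap (comp1 BGrb g f) x = gmap g (gmap f x)) /\
      (forall u : P, ghat (comp1 BGrb g f) u = ghat g (ghat f u))) /\
    (forall P : bundle_gerbe M,
      (forall x : gX P, gmap (id1 BGrb P) x = x) /\
      (forall u : P, ghat (id1 BGrb P) u = u)) /\
    (* vertical composition *)
    (forall (P Q : bundle_gerbe M) (f g h : gerbe_morphism P Q)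
        (lambda : transformation g h) (theta : transformation f g),
      exists lh th c : gX P -> Q,
        is_lift lambda lh /\ is_lift theta th /\
        is_lift (vcomp BGrb lambda theta) c /\
        forall x : gX P, gprod (lh x) (th x) (c x)) /\
    (* identity 2-arrows *)
    (forall (P Q : bundle_gerbe M) (f : gerbe_morphism P Q),
      exists e : gX P -> Q,
        is_lift (id2 BGrb f) e /\ forall x : gX P, gunit (gmap f x) (e x)) /\
    (* horizontal composition *)
    (forall (P Q S : bundle_gerbe M) (f1 f2 : gerbe_morphism P Q)
        (g1 g2 : gerbe_morphism Q S)
        (lambda : transformation g1 g2) (theta : transformation f1 f2),
      exists (lh : gX Q -> S) (th : gX P -> Q) (c : gX P -> S),
        is_lift lambda lh /\ is_lift theta th /\
        is_lift (hcomp BGrb lambda theta) c /\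
        forall x : gX P, gprod (ghat g2 (th x)) (lh (gmap f1 x)) (c x)).
Proof.
exists (BGrb M); split=> [//|]; split=> [//|]; split; last split.
- move=> P Q f g h l t.
  exists (lift_of l), (lift_of t), (lift_of (vertical_comp l t)).
  do 3 (split; first exact: is_lift_of).
  move=> x; rewrite lift_vertical_comp; apply: gprod_gmult.
  by rewrite src_lift tgt_lift.
- move=> P Q f; exists (lift_of (identity2 f)); split; first exact: is_lift_of.
  by move=> x; apply/gunitP; exact: lift_identity2.
move=> P Q S f1 f2 g1 g2 l t.
exists (lift_of l), (lift_of t), (lift_of (horizontal_comp l t)).
do 3 (split; first exact: is_lift_of).
move=> x; rewrite lift_horizontal_comp; apply: gprod_gmult.
by rewrite ghat_src src_lift tgt_lift.
Qed.
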